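(* Let $f(x)=\frac1x$. For Lebesgue-almost every $\alpha\in(0,1)$ it holds that $$\lim_{N\to\infty}\frac{S_N^1(f)(x)}{N\log(N)}=1\qquad\text{for a.e. }x\in[0,1).$$ Furthermore, if $\alpha$ is (irrational and) of bounded type, then $$\lim_{N\to\infty}\frac{S_N^1(f)(x)}{N\log(N)}=1\qquad\text{uniformly in }x\in[0,1).$$
   Context: For irrational $\alpha\in(0,1)$, $R(x)=R_\alpha(x)=x+\alpha\pmod1$ on $[0,1)$, and ''a.e.'' refers to Lebesgue measure. The sum with the largest term removed is $$S_N^1(f)(x)=\sum_{n=0}^{N-1}f(R^nx)-\max_{0\le n\le N-1}f(R^nx),$$ with the convention $f(0)=0$. The number $\alpha=[a_1,a_2,\dots]$ (continued fraction expansion) is of bounded type if $\sup_n a_n<\infty$. *)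

(* Defs.v *)
(* MathComp-Analysis; the reals are an arbitrary [R : realType]. *)
From mathcomp Require Import all_boot all_order all_algebra.
From mathcomp Require Import all_classical all_reals all_analysis.

Set Implicit Arguments.
Unset Strict Implicit.
Unset Printing Implicit Defensive.

Import Order.TTheory GRing.Theory Num.Theory.
Import numFieldNormedType.Exports.

Local Open Scope classical_set_scope.
Local Open Scope ring_scope.

Section Definitions.
Context {R : realType}.
Implicit Types (x alpha : R) (f : R -> R).

Definition frac x : R := x - (Num.floor x)%:~R.

Definition rotation alpha x : R := frac (x + alpha).

(* [trimmed_sum alpha f N x] is S_N^1(f)(x) for N >= 1.  The iterated maximum
   is seeded with f(x), its n = 0 term, so it is the true maximum for every
   f, whatever its sign. *)
Definition trimmed_sum alpha f (N : nat) x : R :=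
  \sum_(0 <= n < N) f (iter n (rotation alpha) x)
  - \big[Num.max/f x]_(0 <= n < N) f (iter n (rotation alpha) x).

(* 1/x, with value 0 at x = 0 since 0^-1 = 0 in MathComp. *)
Definition recip x : R := x^-1.

Definition gauss_map x : R := frac x^-1.

(* For irrational alpha in (0,1) with expansion [a_1, a_2, ...], the value of
   [cf_digit alpha n] is a_(n+1). *)
Definition cf_digit alpha (n : nat) : nat :=
  Num.truncn (iter n gauss_map alpha)^-1.

(* Meaningful for irrational alpha in (0,1) only: the rational case, where the
   expansion is finite, must be excluded separately. *)
Definition bounded_type alpha : Prop :=
  exists M : nat, forall n : nat, (cf_digit alpha n <= M)%N.

End Definitions.

(* Main.v *)
Require Import Defs.
From mathcomp Require Import all_boot all_order all_algebra.
From mathcomp Require Import all_classical all_reals all_analysis.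
From mathcomp Require Import measurable_realfun ring lra zify.

Import Order.TTheory GRing.Theory Num.Theory.
Import numFieldNormedType.Exports.
Local Open Scope classical_set_scope.
Local Open Scope ring_scope.

Set Implicit Arguments.
Unset Strict Implicit.
Unset Printing Implicit Defensive.

Local Notation frac := Defs.frac.

(** Both statements compare the trimmed sum with a sum of bounded observables:
    only the orbit points closest to 0 can spoil the law N log N, and only the
    closest one does.

    Almost every alpha.  Let (alpha, x) be uniform in the unit square.  The
    orbit points frac (x + n alpha) are uniform and, for two different times,
    independent ([expectation_orbit_points]): translating x makes the first
    point uniform, and then multiplication by the nonzero time difference makes
    the second one uniform given the first.  Hence variances of orbit sums can
    be computed as for independent variables.  Consider a level
    d = s / N, where s tends to 0 slowly.  The truncated observable t^-1
      1_(t >= d) has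
    mean ln d^-1 and second moment at most d^-1, so its orbit sum has mean
    N ln d^-1 and variance at most N / d = N^2 / s, while the expected number
    of pairs of times at which the orbit lies below d is at most s^2.  If
    there is no such pair, the trimmed sum is within d^-1 of the truncated sum
    ([trimmed_cutoff_bounds]).  Along geometric times N ~ b^j, with
    s = j^(-3/4), the relative variance 1 / (s j^2) and s^2 are both summable
    in j; so the normalised deviation and the number of pairs form a series
    with finite expectation, and by Tonelli its terms tend to 0 for almost
    every alpha and almost every x ([scale_error_ae]).  As the trimmed sum is
    nondecreasing in N, the asymptotics extend to all times up to a factor
    depending on b, and b tends to 1 ([homo_scale_asymptotics]).

    Bounded type.  Bounded digits give |q alpha - p| >= c / q
    ([bounded_type_badly_approximable]).  Two consequences are used.  First,
    the points of an orbit of length N are c / N apart, so the k-th smallest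
    of them is at least of order k c / N.  Second, by Dirichlet's theorem an
    orbit of length N starts with a block of q >= c N points which shadow a
    translate of the grid of step 1 / q;
      the sum of the decreasing function 1 / (t + d) over
    the block differs from its mean by at most 3 / d ([block_sum]), and
    peeling off such blocks leaves a total error of order d^-1 ln N
    ([damped_orbit_sum]).  With d = A c / N this error is N ln N / A up to
    constants, the mean is N ln N + O(N), and separation bounds the difference
    between the trimmed sum and the sum of 1 / (t + d) by O(N)
    ([trimmed_separated]), all uniformly in x.  Finally A is taken large. *)

(** * Rotations and trimmed sums *)

Lemma ln_le_subr1 (R : realType) (t : R) : 0 < t -> ln t <= t - 1.
Proof.
by move=> t0; rewrite -{1}(subrK 1 t) addrC le_ln1Dx// ltrBrDl subrr.
Qed.

Section FractionalPart.
Context {R : realType}.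
Implicit Types (x y alpha : R).

Lemma frac_ge0 x : 0 <= frac x.
Proof. by rewrite subr_ge0 floor_le. Qed.

Lemma frac_lt1 x : frac x < 1.
Proof. by rewrite ltrBlDr addrC -[X in _ + X]/(1%:~R) -intrD floorD1_gt. Qed.

Lemma frac_eq x y (m : int) : 0 <= y < 1 -> x = y + m%:~R -> frac x = y.
Proof.
move=> /andP[y0 y1] ->; rewrite /frac (@floor_def _ _ m) ?addrK//.
by rewrite lerDr y0 intrD addrC ltrD2l.
Qed.

Lemma frac_id x : 0 <= x < 1 -> frac x = x.
Proof. by move=> x01; apply: (@frac_eq x x 0) => //; rewrite addr0. Qed.

Lemma fracDz x (m : int) : frac (x + m%:~R) = frac x.
Proof.
apply: (@frac_eq _ _ (Num.floor x + m)); first by rewrite frac_ge0 frac_lt1.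
by rewrite intrD addrA subrK.
Qed.

Lemma fracD_frac x y : frac (frac x + y) = frac (x + y).
Proof.
have -> : frac x + y = x + y + (- Num.floor x)%:~R
  by rewrite /frac mulrNz addrAC.
exact: fracDz.
Qed.

Lemma iter_rotation alpha x (n : nat) : 0 <= x < 1 ->
  iter n (rotation alpha) x = frac (x + n%:R * alpha).
Proof.
move=> x01; elim: n => [|n IHn]; first by rewrite mul0r addr0 frac_id.
by rewrite iterS IHn /rotation fracD_frac -addrA -natr1 mulrDl mul1r.
Qed.

End FractionalPart.

Section TrimmedSums.
Context {R : realType}.
Implicit Types (u y : nat -> R) (N : nat).

Definition trimmed u N : R :=
  \sum_(0 <= n < N) u n - \big[Num.max/u 0%N]_(0 <= n < N) u n.

Lemma trimmed_sumE (alpha x : R) N : 0 <= x < 1 ->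
  trimmed_sum alpha recip N x =
  trimmed (fun n => (frac (x + n%:R * alpha))^-1) N.
Proof.
move=> x01; rewrite /trimmed_sum /trimmed /recip mul0r addr0 frac_id//.
by congr (_ - _); apply: eq_bigr => n _; rewrite iter_rotation.
Qed.

(** A new term y changes the sum by y and the maximum by at most y.  This is
    what allows the trimmed sum to be controlled along a subsequence only. *)
Lemma trimmed_homo u : (forall n, 0 <= u n) ->
  {homo trimmed u : m n / (m <= n)%N >-> m <= n}.
Proof.
move=> u0; apply: homo_leq => // [|N]; first exact: le_trans.
rewrite /trimmed big_nat_recr//= !big_mkord; set S := \sum_(_ < _) _.
suff : \big[Num.max/u 0%N]_(n < N.+1) u n <= \big[Num.max/u 0%N]_(n < N) u n +
  u N by lra.
have M0 : 0 <= \big[Num.max/u 0%N]_(n < N) u n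
  by rewrite (le_trans (u0 0%N))// bigmax_ge_id.
apply: bigmax_le => [|n _]; first by rewrite -[leLHS]addr0 lerD// bigmax_ge_id.
have [nN|] := ltnP n N;
  first by rewrite -[leLHS]addr0 lerD//
  (le_bigmax _ (fun i : 'I_N => u i) (Ordinal nN)).
move=> Nn; have -> : n = N :> nat by apply/eqP;
  rewrite eqn_leq Nn andbT -ltnS ltn_ord.
by rewrite lerDr.
Qed.

Lemma trimmed_argmax u N : (0 < N)%N ->
  exists2 n0 : 'I_N, forall n : 'I_N, u n <= u n0 &
    trimmed u N = \sum_(n < N | n != n0) u n.
Proof.
case: N => // N _.
pose n0 : 'I_N.+1 := [arg max_(n > ord0) u n]%O.
have n0_max (n : 'I_N.+1) : u n <= u n0.
  by rewrite /n0; case: Order.TotalTheory.arg_maxP => // i _; apply.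
exists n0 => //; rewrite /trimmed !big_mkord (bigD1 n0)//=.
suff -> : \big[Num.max/u 0%N]_(i < N.+1) u i = u n0
  by rewrite addrAC subrr add0r.
apply/eqP; rewrite eq_le; apply/andP; split.
  by apply: (big_ind (fun t => t <= u n0)) => // [|a b];
    rewrite ?(n0_max ord0)// ge_max => -> ->.
exact: le_bigmax.
Qed.

Definition cutoff (d t : R) : R := if d <= t then t^-1 else 0.

(** If a point lies in ]0, d[, its reciprocal is the removed term; otherwise
    the removed term is at most d^-1.  A point equal to 0 contributes 0 to
    every sum, by the convention on 1/0. *)
Lemma trimmed_cutoff_bounds y N (d : R) : 0 < d -> (0 < N)%N ->
  (forall n, 0 <= y n) ->
    (forall m n : 'I_N, y m < d -> y n < d -> m = n) ->
  \sum_(n < N) cutoff d (y n) - d^-1 <= trimmed (fun n => (y n)^-1) N <=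
  \sum_(n < N) cutoff d (y n).
Proof.
rewrite /cutoff => d0 N0 y0 yd;
  have [n0 n0_max ->] := trimmed_argmax (fun n => (y n)^-1) N0.
have phi_ge0 (n : 'I_N) : 0 <= (if d <= y n then (y n)^-1 else 0).
  by case: ifP => // _; rewrite invr_ge0.
have phi_le (n : 'I_N) : (if d <= y n then (y n)^-1 else 0) <= (y n)^-1.
  by case: ifP => // _; rewrite invr_ge0.
have phi_led (n : 'I_N) : (if d <= y n then (y n)^-1 else 0) <= d^-1.
  case: ifPn => [dy|_]; last by rewrite invr_ge0 ltW.
  by rewrite lef_pV2// posrE (lt_le_trans d0).
rewrite (bigD1 n0)//=; apply/andP; split.
  rewrite lerBlDr [leRHS]addrC; apply: lerD; first exact: phi_led.
  by apply: ler_sum => n _; exact: phi_le.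
apply: (@le_trans _ _
  (\sum_(n < N | n != n0) (if d <= y n then (y n)^-1 else 0))); last first.
  by rewrite lerDr phi_ge0.
apply: ler_sum => n nn0; case: ifPn => //; rewrite -ltNge => ynd.
have dy0 : d <= y n0.
  by rewrite leNgt; apply: contra nn0 => y0d; apply/eqP; exact: yd.
(* y n, if nonzero, would give a term larger than the maximal one *)
rewrite invr_le0 leNgt; apply/negP => yn0.
have := n0_max n; rewrite leNgt ltf_pV2 ?posrE ?(lt_le_trans ynd)//.
exact: lt_le_trans dy0.
Qed.

End TrimmedSums.

(** * Affine circle maps preserve Lebesgue measure *)

Section MeasurePreservation.
Context {R : realType}.
Local Open Scope ereal_scope.
Local Notation mu := (@lebesgue_measure R).

Definition affine (k c : R) : R -> measurableTypeR R := fun x => (k * x + c)%R.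

Lemma measurable_affine k c : measurable_fun [set: measurableTypeR R]
  (affine k c).
Proof.
by apply: measurable_funD => //; apply: measurable_funM.
Qed.

Definition affine_image (k c : R) : {measure set (measurableTypeR R) -> \bar R}.
Proof.
unshelve refine (pushforward mu (affine k c) : {measure set _ -> \bar R}).
exact: measurable_affine.
Defined.

Lemma affine_preimage_itv (k c : R) (b1 b2 : bool) (a b : R) : (0 < k)%R ->
  affine k c @^-1` [set` Interval (BSide b1 a) (BSide b2 b)] =
  [set` Interval (BSide b1 ((a - c) / k)%R) (BSide b2 ((b - c) / k)%R)].
Proof.
move=> k0; apply/seteqP; split => x /=; rewrite !in_itv /= /affine;
  case: b1 b2 => [] [] /=;
    rewrite ?(ler_pdivrMr, ltr_pdivrMr, ler_pdivlMr, ltr_pdivlMr)//;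
  lra.
Qed.

(** Both sides agree on half-open intervals, which determine the measure. *)
Lemma affine_measure (k c : R) (k0 : (0 < k)%R) (A : set R) : measurable A ->
  mu A = mscale (NngNum (ltW k0)) (affine_image k c) A.
Proof.
move=> mA; apply: lebesgue_measure_unique => //= _ [[a b]] _ <-.
rewrite /mscale/= /pushforward affine_preimage_itv// !lebesgue_measure_itv/=
  !lte_fin.
rewrite ltr_pM2r ?invr_gt0// ltrD2r; case: ifP => _; last by rewrite mule0.
by rewrite -EFinB -EFinM -mulrBl opprB addrA subrK mulrC divfK// gt_eqF.
Qed.

Lemma integral_affine (k c : R) (D : set R) (h : R -> \bar R) : (0 < k)%R ->
  measurable D -> measurable_fun setT h -> (forall x, 0 <= h x) ->
  \int[mu]_(x in D) h x = k%:E * \int[mu]_(x in affine k c @^-1` D) h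
    (k * x + c)%R.
Proof.
move=> k0 mD mh h0.
rewrite -[RHS](_ : \int[mscale (NngNum (ltW k0)) (affine_image k c)]_(x in D) h
  x = _).
  by apply: eq_measure_integral => A mA AD; exact: affine_measure.
rewrite ge0_integral_mscale//; last exact: measurable_funTS.
rewrite ge0_integral_pushforward//; first exact: measurable_affine.
exact: measurable_funTS.
Qed.

End MeasurePreservation.

Section PeriodicIntegral.
Context {R : realType}.
Local Open Scope ereal_scope.
Local Notation mu := (@lebesgue_measure R).
Variable h : R -> \bar R.
Hypothesis mh : measurable_fun [set: R] h.
Hypothesis h0 : forall x, 0 <= h x.
Hypothesis hD1 : forall x, h (x + 1)%R = h x.

Let J (a b : R) := \int[mu]_(x in `[a, b[) h x.

Let J_cat (a b c : R) : (a <= b)%R -> (b <= c)%R -> J a c = J a b + J b c.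
Proof.
move=> ab bc; rewrite /J -ge0_integral_setU//; first last.
- apply/disj_setPRL => x /=; rewrite !in_itv/= => /andP[? ?] /andP[? ?]; lra.
- exact: measurable_funTS.
by rewrite -itv_bndbnd_setU//= bnd_simp.
Qed.

Let J_shift (a b : R) : J (a + 1) (b + 1) = J a b.
Proof.
rewrite /J (@integral_affine _ 1%R 1%R)// mul1e affine_preimage_itv//.
rewrite !addrK !divr1; apply: eq_integral => x _.
by rewrite mul1r hD1.
Qed.

Let J_period (a : R) : (0 <= a <= 1)%R -> J a (a + 1) = J 0 1.
Proof.
move=> /andP[a0 a1]; rewrite (J_cat a1) ?lerDr//.
by rewrite -{2}(add0r 1%R) J_shift addeC -J_cat.
Qed.

Let J_shiftn (a b : R) (n : nat) : J (a + n%:R) (b + n%:R) = J a b.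
Proof.
by elim: n => [|n IHn]; rewrite ?addr0// -natr1 !addrA J_shift.
Qed.

Let J_periods (a : R) (k : nat) : (0 <= a <= 1)%R ->
  J a (a + k%:R) = k%:R%:E * J 0 1.
Proof.
move=> a01; elim: k => [|k IHk].
  by rewrite addr0 mul0e /J set_itvco0 integral_set0.
rewrite -natr1 addrA (@J_cat _ (a + k%:R)%R) ?lerDl// IHk.
have -> : (a + k%:R + 1 = a + 1 + k%:R)%R by rewrite addrAC.
by rewrite J_shiftn J_period// EFinD ge0_muleDl ?mul1e// lee_fin.
Qed.

(** After the affine change of variables the integral runs over k periods,
    and each of them contributes the same amount. *)
Lemma integral_periodic_affine (k : nat) (c : R) : (0 < k)%N ->
  (0 <= c <= 1)%R ->
  \int[mu]_(x in `[0%R, 1%R[) h (k%:R * x + c)%R =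
    \int[mu]_(x in `[0%R, 1%R[) h x.
Proof.
move=> k0 c01; have k0' : (0 < k%:R :> R)%R by rewrite ltr0n.
have := J_periods k c01; rewrite /J (integral_affine c k0')//.
rewrite affine_preimage_itv// subrr mul0r addrAC subrr add0r divff ?gt_eqF//.
have kV : (k%:R^-1%:E * k%:R%:E = 1 :> \bar R) by rewrite -EFinM mulVf// gt_eqF.
by move=> /(congr1 (fun t => k%:R^-1%:E * t)); rewrite !muleA kV !mul1e.
Qed.

End PeriodicIntegral.

(** * Orbit points are pairwise independent *)

Section UniformMeasure.
Context {R : realType}.
Local Open Scope ereal_scope.
Local Notation mu := (@lebesgue_measure R).

Lemma lebesgue_unit_interval : mu `[0%R, 1%R[ = 1.
Proof. by rewrite lebesgue_measure_itv/= lte01 oppr0 adde0. Qed.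

Lemma lebesgue_unit_interval_fin : mu `[0%R, 1%R[ < +oo.
Proof. by rewrite lebesgue_unit_interval ltry. Qed.

(** The restriction of Lebesgue measure to [0, 1[, seen as a measure on the
    line, so that Tonelli's theorem applies to functions defined everywhere. *)
Definition uniform01 : {finite_measure set (measurableTypeR R) -> \bar R} :=
  @mfrestr _ (measurableTypeR R) R
    `[0%R, 1%R[%classic mu (measurable_itv `[0%R, 1%R[)
    lebesgue_unit_interval_fin.
Local Notation U := uniform01.

Lemma integral_uniform01 (f : R -> \bar R) :
  measurable_fun [set: R] f -> (forall x, 0 <= f x) ->
  \int[U]_x f x = \int[mu]_(x in `[0%R, 1%R[) f x.
Proof.
move=> mf f0; rewrite
  (@ge0_negligible_integral _ _ _ U setT (~` `[0%R, 1%R[))//.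
- rewrite setDE setTI setCK; apply: eq_measure_integral => A mA AS.
  by rewrite /U /= /mfrestr /mrestr (setIidl AS).
- exact: measurableC.
- by rewrite /U /= /mfrestr /mrestr setICl measure0.
Qed.

Lemma uniform01_ae (P : R -> Prop) : {ae U, forall x, P x} ->
  {ae mu, forall x, (0 <= x < 1)%R -> P x}.
Proof.
move=> [N [mN UN0 PN]]; exists (N `&` `[0%R, 1%R[); split => //.
  exact: measurableI.
by move=> x /= /not_implyP[x01 nPx]; split; [exact: PN|rewrite /= in_itv].
Qed.

Lemma uniform01_cst (c : \bar R) : \int[U]_x c = c.
Proof.
rewrite integral_cst//=.
by rewrite /mfrestr /mrestr setTI lebesgue_unit_interval mule1.
Qed.

Lemma measurable_frac : measurable_fun [set: R] (@frac R).
Proof.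
apply: measurable_funB => //; apply: nondecreasing_measurable => // x y xy.
by rewrite ler_int le_floor.
Qed.

Lemma frac_affine_preserving (h : R -> \bar R) (k : nat) (c : R) :
  measurable_fun [set: R] h -> (forall x, 0 <= h x) -> (0 < k)%N ->
  \int[U]_x h (frac (k%:R * x + c)) = \int[U]_x h x.
Proof.
move=> mh h0 k0.
have mhf : measurable_fun [set: R] (h \o frac)
  by exact: measurableT_comp measurable_frac.
rewrite integral_uniform01//; last first.
  by apply: (measurableT_comp mhf); exact: measurable_affine.
transitivity (\int[mu]_(x in `[0%R, 1%R[) (h \o frac) (k%:R * x + frac c)%R).
  by apply: eq_integral => x _ /=; rewrite addrC -fracD_frac addrC.
rewrite integral_periodic_affine//.
- rewrite integral_uniform01//; apply: eq_integral => x;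
  rewrite inE/= in_itv/= => x01.
  by rewrite frac_id.
- by move=> x; exact: h0.
- by move=> x /=; rewrite -[in RHS](fracDz x 1).
- by rewrite frac_ge0 ltW// frac_lt1.
Qed.

End UniformMeasure.

Section PairwiseIndependence.
Context {R : realType}.
Local Open Scope ereal_scope.
Local Notation mu := (@lebesgue_measure R).
Local Notation U := (@uniform01 R).
Local Notation P := (U \x U).
Local Notation T := (measurableTypeR R * measurableTypeR R)%type.

Definition orbit_point (n : nat) (z : T) : R := frac (z.2 + n%:R * z.1).

Lemma measurable_orbit_point n : measurable_fun [set: T] (orbit_point n).
Proof.
apply: (measurableT_comp measurable_frac); apply: measurable_funD => //.
exact: measurable_funM.
Qed.

Lemma expectation_orbit_point (f : R -> \bar R) n :
  measurable_fun [set: R] f -> (forall x, 0 <= f x) ->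
  \int[P]_z f (orbit_point n z) = \int[U]_x f x.
Proof.
move=> mf f0; rewrite fubini_tonelli1//;
  last exact: measurableT_comp (measurable_orbit_point n).
rewrite /fubini_F -[RHS]uniform01_cst; apply: eq_integral => a _.
rewrite -(@frac_affine_preserving _ f 1 (n%:R * a))//.
by apply: eq_integral => x _; rewrite /orbit_point /= mul1r.
Qed.

(** Integrating over x first, a translation turns the pair of points into
    (x, frac (x + (n - m) alpha)); integrating over alpha next, the second
    point is uniform for every fixed x because n - m is nonzero. *)
Lemma expectation_orbit_points (f g : R -> R) m n : (m < n)%N ->
  measurable_fun [set: R] f -> (forall x, (0 <= f x)%R) ->
  measurable_fun [set: R] g -> (forall x, (0 <= g x)%R) ->
  \int[P]_z (f (orbit_point m z) * g (orbit_point n z))%:E =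
  (\int[U]_x (f x)%:E) * (\int[U]_x (g x)%:E).
Proof.
move=> mn mf f0 mg g0.
have k0 : (0 < n - m)%N by rewrite subn_gt0.
have mfrac := @measurable_frac R.
have mpt k : measurable_fun [set: T] (fun z : T => frac (z.2 + k%:R * z.1)).
  exact: measurable_orbit_point.
rewrite fubini_tonelli1//; last 2 first.
- apply/measurable_EFinP; apply: measurable_funM.
    exact: measurableT_comp (measurable_orbit_point m).
  exact: measurableT_comp (measurable_orbit_point n).
- by move=> z; rewrite lee_fin mulr_ge0.
transitivity (\int[U]_a \int[U]_x (f x * g (frac (x + (n - m)%:R * a)))%:E).
  apply: eq_integral => a _; rewrite /fubini_F/=.
  rewrite -(@frac_affine_preserving _
    (fun x => (f x * g (frac (x + (n - m)%:R * a)))%:E) 1 (m%:R * a))//.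
  - apply: eq_integral => x _;
    rewrite /orbit_point /= mul1r fracD_frac -addrA -mulrDl -natrD.
    by rewrite subnKC// ltnW.
  - apply/measurable_EFinP; apply: measurable_funM => //.
    apply: measurableT_comp => //; apply: measurableT_comp => //.
    exact: measurable_funD.
  - by move=> x; rewrite lee_fin mulr_ge0.
have mfg : measurable_fun [set: T] (fun z : T =>
  (f z.2 * g (frac (z.2 + (n - m)%:R * z.1)))%:E).
  apply/measurable_EFinP; apply: measurable_funM => //.
    exact: measurableT_comp.
  exact: measurableT_comp.
rewrite (fubini_tonelli (fun z : T =>
  (f z.2 * g (frac (z.2 + (n - m)%:R * z.1)))%:E))//=; last first.
  by move=> z; rewrite lee_fin mulr_ge0.
have mg' : measurable_fun [set: R] (EFin \o g) by exact/measurable_EFinP.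
transitivity (\int[U]_x ((f x)%:E * \int[U]_y (g y)%:E)).
  apply: eq_integral => x _;
    have <- := @frac_affine_preserving _ (EFin \o g) (n - m) x mg' _ k0;
    last first.
    by move=> y; rewrite lee_fin.
  under eq_integral do rewrite EFinM addrC.
  rewrite ge0_integralZl ?lee_fin// => [|y _]; last by rewrite lee_fin.
  apply/measurable_EFinP; apply: measurableT_comp => //;
    apply: measurableT_comp => //.
  exact: measurable_affine.
rewrite ge0_integralZr//.
- exact/measurable_EFinP.
- by move=> y _; rewrite lee_fin.
- by apply: integral_ge0 => y _; rewrite lee_fin.
Qed.

End PairwiseIndependence.

(** * First and second moments of the truncated sums *)

Section CutoffMoments.
Context {R : realType}.
Local Open Scope ereal_scope.
Local Notation mu := (@lebesgue_measure R).
Local Notation U := (@uniform01 R).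
Variable d : R.
Hypothesis d_gt0 : (0 < d)%R.
Hypothesis d_lt1 : (d < 1)%R.

Let d_le_gt0 x : (d <= x)%R -> (0 < x)%R.
Proof. exact: lt_le_trans. Qed.

Let mem_itvcy x : (x \in `[d, +oo[%classic) = (d <= x)%R.
Proof. by apply/idP/idP; rewrite inE/= in_itv/= andbT. Qed.

Let is_derive_integral_uniform01 (f F : R -> R) :
  measurable_fun [set: R] (fun x => if (d <= x)%R then f x else 0%R) ->
  (forall x, (d <= x)%R -> (0 <= f x)%R) ->
  (forall x, (d <= x)%R -> {for x, continuous f}) ->
  (forall x, (d <= x)%R -> is_derive x 1%R F (f x)) ->
  \int[U]_x (if (d <= x)%R then f x else 0%R)%:E = (F 1%R - F d)%:E.
Proof.
move=> mf f0 cf dF; rewrite integral_uniform01; last 2 first.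
- exact/measurable_EFinP.
- by move=> x; rewrite lee_fin; case: ifPn => // /f0.
have -> : (fun x => (if (d <= x)%R then f x else 0%R)%:E) =
    (EFin \o f) \_ `[d, +oo[%classic.
  by apply/funext => x; rewrite patchE mem_itvcy; case: ifP.
rewrite -integral_mkcondr.
have -> : `[0%R, 1%R[ `&` `[d, +oo[ = `[d, 1%R[%classic.
  apply/seteqP; split => x /=; rewrite !in_itv/= ?andbT.
    by move=> [/andP[_ ->] ->].
  by move=> /andP[dx ->]; rewrite dx (le_trans (ltW d_gt0)).
have Fd x : (d <= x)%R -> derivable F x 1 by move=> /dF [].
have Fc x : (d <= x)%R -> {for x, continuous F}.
  by move=> dx; apply/differentiable_continuous/derivable1_diffP/Fd.
rewrite integral_itv_bndo_bndc; last first.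
  apply/measurable_EFinP.
  apply: (@subspace_continuous_measurable_fun _ `[d, 1%R[%classic) => //.
  apply: continuous_in_subspaceT => x /set_mem/=;
    rewrite in_itv/= => /andP[dx _].
  exact: cf.
rewrite (@continuous_FTC2 _ f F)//.
- apply: continuous_in_subspaceT => x /set_mem/=;
  rewrite in_itv/= => /andP[dx _].
  exact: cf.
- split.
  + by move=> x; rewrite in_itv/= => /andP[dx _]; apply: Fd; rewrite ltW.
  + by apply: cvg_at_right_filter; exact: Fc.
  + by apply: cvg_at_left_filter; apply: Fc; rewrite ltW.
- move=> x; rewrite in_itv/= => /andP[dx _].
  by rewrite derive1E; have [_ ->] := dF x (ltW dx).
Qed.

Let cutoffX (n : nat) x : (0 < n)%N ->
  (cutoff d x ^+ n = if (d <= x)%R then x ^- n else 0)%R.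
Proof.
by move=> n0; rewrite /cutoff; case: ifP; rewrite ?exprVn// expr0n gtn_eqF.
Qed.

Lemma measurable_cutoff : measurable_fun [set: R] (cutoff d).
Proof.
have -> : cutoff d = (fun x : R => x^-1)%R \_ `[d, +oo[%classic.
  by apply/funext => x; rewrite patchE mem_itvcy.
apply/(measurable_restrictT _ _).1 => //.
apply: subspace_continuous_measurable_fun => //.
apply: continuous_in_subspaceT => x /set_mem/=; rewrite in_itv/= andbT => dx.
by apply: inv_continuous; rewrite gt_eqF// d_le_gt0.
Qed.

Lemma cutoff_ge0 x : (0 <= cutoff d x)%R.
Proof.
rewrite /cutoff; case: ifPn => // dx.
by rewrite invr_ge0 ltW// d_le_gt0.
Qed.

Lemma cutoff_moment1 : \int[U]_x (cutoff d x)%:E = (ln d^-1)%:E.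
Proof.
have -> : (ln d^-1 = ln 1 - ln d)%R by rewrite ln1 sub0r lnV ?posrE.
apply: (@is_derive_integral_uniform01 (fun x => x^-1)%R (@ln R)) => //.
- exact: measurable_cutoff.
- by move=> x dx; rewrite invr_ge0 ltW// d_le_gt0.
- by move=> x dx; apply: inv_continuous; rewrite gt_eqF// d_le_gt0.
- by move=> x dx; apply: is_derive1_ln; exact: d_le_gt0.
Qed.

Lemma cutoff_moment2 : \int[U]_x (cutoff d x ^+ 2)%:E = (d^-1 - 1)%:E.
Proof.
under eq_integral do rewrite cutoffX//.
have -> : (d^-1 - 1 = - 1^-1 - - d^-1 :> R)%R by rewrite invr1 opprK addrC.
apply: (@is_derive_integral_uniform01 (fun x => x ^- 2)%R (fun x => - x^-1)%R).
- have -> : (fun x => if d <= x then x ^- 2 else 0)%R =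
  (fun x => cutoff d x ^+ 2)%R.
    by apply/funext => x; rewrite cutoffX.
  by apply: measurable_funX; exact: measurable_cutoff.
- by move=> x dx; rewrite invr_ge0 exprn_ge0// ltW// d_le_gt0.
- move=> x dx; apply: (@continuousV _ _ (fun x : R => x ^+ 2)%R).
    by rewrite gt_eqF// exprn_gt0// d_le_gt0.
  exact: exprn_continuous.
- move=> x dx; have x0 : x != 0%R by rewrite gt_eqF// d_le_gt0.
  have -> : (x ^- 2 = - (- x ^- 2 *: 1))%R
    by rewrite scaleNr opprK [_ *: _]mulr1.
  apply: is_deriveN; apply: DeriveDef; first exact: derivableV.
  by rewrite deriveV// derive_id.
Qed.

Lemma uniform01_lt : \int[U]_x ((x < d)%R%:R)%:E = d%:E.
Proof.
transitivity (\int[U]_x (\1_(`]-oo, d[%classic : set R) x)%:E).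
  apply: eq_integral => x _; rewrite indicE.
  suff -> : (x \in `]-oo, d[%classic) = (x < d)%R by [].
  by apply/idP/idP; rewrite inE/= in_itv.
rewrite integral_indic// setIT /U /= /mfrestr /mrestr.
have -> : `]-oo, d[ `&` `[0%R, 1%R[ = `[0%R, d[%classic.
  apply/seteqP; split => x /=; rewrite !in_itv/=.
    by move=> [-> /andP[->]].
  by move=> /andP[-> xd]; rewrite xd (lt_trans xd).
by rewrite lebesgue_measure_itv/= lte_fin d_gt0 oppr0 adde0.
Qed.

End CutoffMoments.

Section SecondMoments.
Context {R : realType}.
Local Open Scope ereal_scope.
Local Notation U := (@uniform01 R).
Local Notation P := (U \x U).
Local Notation T := (measurableTypeR R * measurableTypeR R)%type.
Variables (d : R) (N : nat).
Hypothesis d_gt0 : (0 < d)%R.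
Hypothesis d_lt1 : (d < 1)%R.

Definition cutoff_sum (z : T) : R := \sum_(n < N) cutoff d (orbit_point n z).

Definition close_pairs (z : T) : R :=
  \sum_(n < N) \sum_(m < N)
    if (m < n)%N then (orbit_point m z < d)%R%:R * (orbit_point n z < d)%R%:R
      else 0.

Let measurable_cutoff_orbit n :
  measurable_fun [set: T] (fun z => cutoff d (orbit_point n z)).
Proof.
exact: measurableT_comp (measurable_cutoff d_gt0) (measurable_orbit_point n).
Qed.

Let measurable_lt : measurable_fun [set: R] (fun x : R => (x < d)%R%:R : R).
Proof.
have -> : (fun x : R => (x < d)%R%:R : R) = \1_(`]-oo, d[%classic : set R).
  apply/funext => x; rewrite indicE.
  suff -> : (x \in `]-oo, d[%classic) = (x < d)%R by [].
  by apply/idP/idP; rewrite inE/= in_itv.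
exact: measurable_indic.
Qed.

Let measurable_lt_orbit n :
  measurable_fun [set: T] (fun z => (orbit_point n z < d)%R%:R : R).
Proof. exact: measurableT_comp measurable_lt (measurable_orbit_point n). Qed.

Lemma measurable_cutoff_sum : measurable_fun [set: T] cutoff_sum.
Proof. by rewrite /cutoff_sum; apply: measurable_sum => n. Qed.

Let measurable_close_pair (m n : 'I_N) :
  measurable_fun [set: T] (fun z => if (m < n)%N then
    (orbit_point m z < d)%R%:R * (orbit_point n z < d)%R%:R else 0 : R)%R.
Proof. by case: (m < n)%N; [exact: measurable_funM|exact: measurable_cst]. Qed.

Let close_pair_ge0 (m n : 'I_N) (z : T) :
  (0 <= if (m < n)%N then (orbit_point m z < d)%R%:R *
    (orbit_point n z < d)%R%:R else 0 :> R)%R.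
Proof. by case: ifP => // _; rewrite mulr_ge0. Qed.

Lemma close_pairs_ge0 z : (0 <= close_pairs z)%R.
Proof. by apply: sumr_ge0 => n _; apply: sumr_ge0. Qed.

Lemma measurable_close_pairs : measurable_fun [set: T] close_pairs.
Proof.
rewrite /close_pairs; apply: measurable_sum => n; apply: measurable_sum => m.
exact: measurable_close_pair.
Qed.

Lemma expectation_cst (c : \bar R) : 0 <= c -> \int[P]_z c = c.
Proof.
move=> c0; have := @expectation_orbit_point R (cst c) 0 (measurable_cst _)
  (fun=> c0).
by rewrite uniform01_cst.
Qed.

Let L := ln d^-1.

Let L_ge0 : (0 <= L)%R.
Proof. by rewrite /L ln_ge0// invf_ge1// ltW. Qed.

Let expectation_cutoff_sum : \int[P]_z (cutoff_sum z)%:E = (N%:R * L)%:E.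
Proof.
under eq_integral do rewrite -sumEFin.
rewrite ge0_integral_sum//; last 2 first.
- by move=> n; exact/measurable_EFinP.
- by move=> n z _; rewrite lee_fin cutoff_ge0 //.
under eq_bigr => n _.
  rewrite (expectation_orbit_point (f := fun x => (cutoff d x)%:E))
    ?cutoff_moment1//; last 2 first.
  - by apply/measurable_EFinP; exact: measurable_cutoff.
  - by move=> x; rewrite lee_fin cutoff_ge0 //.
  over.
by rewrite sumEFin sumr_const card_ord mulr_natl.
Qed.

Let expectation_cutoff_sum2 :
  \int[P]_z (cutoff_sum z ^+ 2)%:E <= (N%:R / d + (N%:R * L) ^+ 2)%:E.
Proof.
have E2 (m n : 'I_N) :
    \int[P]_z (cutoff d (orbit_point m z) * cutoff d (orbit_point n z))%:E <=
    ((m == n)%:R / d + L ^+ 2)%:E.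
  have off m' n' : (m' < n')%N ->
      \int[P]_z (cutoff d (orbit_point m' z) * cutoff d (orbit_point n' z))%:E =
        (L ^+ 2)%:E.
    move=> mn; rewrite expectation_orbit_points// ?cutoff_moment1// -?EFinM//;
      by [exact: measurable_cutoff|move=> x; apply: cutoff_ge0].
  case: (ltngtP m n) => mn.
  - rewrite off// lee_fin lerDr mulr_ge0// invr_ge0 ltW//.
  - under eq_integral do rewrite mulrC.
    by rewrite off// lee_fin lerDr mulr_ge0// invr_ge0 ltW.
  - have -> : m = n by exact: val_inj.
    rewrite eqxx mul1r.
    rewrite (expectation_orbit_point (f := fun x => (cutoff d x ^+ 2)%:E));
      last 2 first.
    + by apply/measurable_EFinP; apply: measurable_funX;
      exact: measurable_cutoff.
    + by move=> x; rewrite lee_fin sqr_ge0.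
    by rewrite cutoff_moment2// lee_fin; have := sqr_ge0 L; lra.
under eq_integral.
  move=> z _; rewrite expr2 /cutoff_sum mulr_suml -sumEFin.
  under eq_bigr do rewrite mulr_sumr -sumEFin.
  over.
rewrite ge0_integral_sum//; last 2 first.
- move=> m; apply: emeasurable_sum => n.
  exact/measurable_EFinP/measurable_funM.
- by move=> m z _; apply: sume_ge0 => n _;
  rewrite lee_fin mulr_ge0// cutoff_ge0 //.
under eq_bigr => m _.
  rewrite ge0_integral_sum//; last 2 first.
  - by move=> n; exact/measurable_EFinP/measurable_funM.
  - by move=> n z _; rewrite lee_fin mulr_ge0// cutoff_ge0 //.
  over.
apply: (@le_trans _ _
  (\sum_(m < N) \sum_(n < N) ((m == n)%:R / d + L ^+ 2)%:E)).
  by apply: lee_sum => m _; apply: lee_sum => n _; exact: E2.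
under eq_bigr do rewrite sumEFin.
rewrite sumEFin lee_fin.
under eq_bigr => m _.
  rewrite big_split/= -mulr_suml (bigD1 m)//= eqxx big1 ?addr0; last first.
    by move=> n; rewrite eq_sym => /negbTE ->.
  over.
rewrite big_split/= !sumr_const !card_ord div1r -mulrnA.
by rewrite -[(d^-1 *+ N)%R]mulr_natl -[(_ *+ (N * N)%N)%R]mulr_natl natrM exprMn
  -expr2.
Qed.

(** Pairwise independence suffices for the variance of a sum to be the sum of
    the variances.  To remain within nonnegative integrals, 2 M Y is added to
    (Y - M)^2, which gives Y^2 + M^2. *)
Lemma cutoff_sum_variance :
  \int[P]_z ((cutoff_sum z - N%:R * ln d^-1) ^+ 2)%:E <= (N%:R / d)%:E.
Proof.
set M := (N%:R * ln d^-1)%R; have M0 : (0 <= M)%R by rewrite mulr_ge0.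
have Y0 z : (0 <= cutoff_sum z)%R by apply: sumr_ge0 => n _; apply: cutoff_ge0.
have mY := measurable_cutoff_sum.
have expand : \int[P]_z ((cutoff_sum z - M) ^+ 2)%:E + (2 * M ^+ 2)%:E =
    \int[P]_z (cutoff_sum z ^+ 2)%:E + (M ^+ 2)%:E.
  transitivity (\int[P]_z
    (((cutoff_sum z - M) ^+ 2)%:E + ((2 * M) * cutoff_sum z)%:E)).
    rewrite ge0_integralD//; last 4 first.
    - by move=> z _; rewrite lee_fin sqr_ge0.
    - by apply/measurable_EFinP; apply: measurable_funX; exact: measurable_funB.
    - by move=> z _; rewrite lee_fin !mulr_ge0.
    - by apply/measurable_EFinP; exact: measurable_funM.
    congr (_ + _); under eq_integral do rewrite EFinM.
    rewrite ge0_integralZl//; last 3 first.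
    - exact/measurable_EFinP.
    - by move=> z _; rewrite lee_fin.
    - by rewrite lee_fin mulr_ge0.
    by rewrite expectation_cutoff_sum -EFinM -mulrA -expr2.
  transitivity (\int[P]_z ((cutoff_sum z ^+ 2)%:E + (M ^+ 2)%:E)).
    by apply: eq_integral => z _; rewrite -!EFinD; congr (_%:E); ring.
  rewrite ge0_integralD//; last 3 first.
  - by move=> z _; rewrite lee_fin sqr_ge0.
  - by apply/measurable_EFinP; exact: measurable_funX.
  - by move=> z _; rewrite lee_fin sqr_ge0.
  by rewrite expectation_cst// lee_fin sqr_ge0.
have := expectation_cutoff_sum2;
  rewrite -/L -/M -(@leeD2rE _ (M ^+ 2)%:E)// -expand.
rewrite -EFinD; case: (\int[P]_z _) => [r| |]; last by move=> _; rewrite leNye.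
  by rewrite -!EFinD !lee_fin; lra.
by rewrite addye// leye_eq.
Qed.

Lemma close_pairs_expectation : \int[P]_z (close_pairs z)%:E <=
  ((N%:R * d) ^+ 2)%:E.
Proof.
under eq_integral.
  move=> z _; rewrite /close_pairs -sumEFin.
  under eq_bigr do rewrite -sumEFin.
  over.
rewrite ge0_integral_sum//; last 2 first.
- by move=> n; apply: emeasurable_sum => m; exact/measurable_EFinP.
- by move=> n z _; apply: sume_ge0 => m _; rewrite lee_fin.
apply: (@le_trans _ _ (\sum_(n < N) \sum_(m < N) (d ^+ 2)%:E)).
  apply: lee_sum => n _; rewrite ge0_integral_sum//; last 2 first.
  - by move=> m; exact/measurable_EFinP.
  - by move=> m z _; rewrite lee_fin.
  apply: lee_sum => m _; have [mn|_] := boolP (m < n)%N; last first.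
    by rewrite expectation_cst// lee_fin sqr_ge0.
  rewrite (expectation_orbit_points (f := fun x => (x < d)%R%:R) (g := fun x =>
    (x < d)%R%:R))//.
  by rewrite !uniform01_lt// -EFinM.
under eq_bigr do rewrite sumEFin sumr_const card_ord.
by rewrite sumEFin sumr_const card_ord lee_fin exprMn -mulrnA -[leLHS]mulr_natl
  natrM expr2.
Qed.

End SecondMoments.

(** * Almost sure asymptotics along a geometric sequence of times *)

Section AlmostEverywhere.
Context {R : realType}.
Local Open Scope ereal_scope.
Local Notation mu := (@lebesgue_measure R).
Local Notation U := (@uniform01 R).
Local Notation P := (U \x U).
Local Notation T := (measurableTypeR R * measurableTypeR R)%type.

Lemma nneseries_fin_cvg0 (u : nat -> R) : (forall n, (0 <= u n)%R) ->
  \sum_(j <oo) (u j)%:E \is a fin_num -> u @ \oo --> (0 : R)%R.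
Proof.
move=> u0 fu; apply: cvg_series_cvg_0; apply: nondecreasing_is_cvgn.
  by apply/nondecreasing_seqP => n;
    rewrite !seriesEnat /= big_nat_recr//= lerDl.
exists (fine (\sum_(j <oo) (u j)%:E)) => _ [n _ <-].
rewrite -lee_fin fineK// seriesEnat /= -sumEFin big_mkord
  -(big_mkord xpredT (fun j => (u j)%:E)).
by apply: nneseries_lim_ge => j _ _; rewrite lee_fin.
Qed.

(** The Borel-Cantelli argument, with expectations: the sum of the series has
    finite expectation, hence is finite almost everywhere, hence its terms
    tend to 0.  Tonelli's theorem splits the null set into its fibres. *)
Lemma summable_expectation_ae_cvg0 (G : nat -> T -> R) :
  (forall j, measurable_fun [set: T] (G j)) -> (forall j z, (0 <= G j z)%R) ->
  \sum_(j <oo) \int[P]_z (G j z)%:E < +oo ->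
  {ae mu, forall a, (0 <= a < 1)%R -> {ae mu, forall x, (0 <= x < 1)%R ->
    G ^~ (a, x) @ \oo --> (0 : R)%R}}.
Proof.
move=> mG G0 GP.
pose F z := \sum_(j <oo) (G j z)%:E.
have mF : measurable_fun [set: T] F.
  by apply: ge0_emeasurable_sum => [j z _ _|j _];
    [rewrite lee_fin|exact/measurable_EFinP].
have F0 z : 0 <= F z by apply: nneseries_ge0 => j _ _; rewrite lee_fin.
have iF : P.-integrable [set: T] F.
  apply/integrableP; split => //.
  under eq_integral do rewrite gee0_abs//.
  rewrite integral_nneseries// => j; first exact/measurable_EFinP.
  by move=> z _; rewrite lee_fin.
apply: uniform01_ae; apply: filterS (ae_integrable1 iF) => a iFa.
apply: uniform01_ae; apply: filterS (integrable_ae measurableT iFa) =>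
  x /(_ Logic.I).
exact: nneseries_fin_cvg0.
Qed.

End AlmostEverywhere.

Section GeometricScale.
Context {R : realType}.
Local Notation mu := (@lebesgue_measure R).
Local Notation U := (@uniform01 R).
Local Notation P := (U \x U)%E.
Local Notation T := (measurableTypeR R * measurableTypeR R)%type.
Variable b : R.
Hypothesis b_gt1 : 1 < b.

(** The fourth root of j + 1, so that all the powers of j below are integral
    powers of it. *)
Definition root4 (j : nat) : R := Num.sqrt (Num.sqrt j.+1%:R).
Definition scale (j : nat) : nat := (Num.truncn (b ^+ j.+1)).+1.
(** The level s / N with N = scale j and s = (j + 1)^(-3/4).  Any exponent
    strictly between -1 and -1/2 makes the two error terms summable. *)
Definition level (j : nat) : R := (root4 j ^+ 3 * (scale j)%:R)^-1.

Local Notation w := root4.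

Lemma root4_exp4 j : w j ^+ 4 = j.+1%:R.
Proof. by rewrite (exprM _ 2 2) sqr_sqrtr// sqr_sqrtr. Qed.

Lemma root4_ge1 j : 1 <= w j.
Proof.
by rewrite -[leLHS]sqrtr1 ler_sqrt// -[leLHS]sqrtr1 ler_sqrt// ler1n.
Qed.

Let w_gt0 j : 0 < w j. Proof. by rewrite (lt_le_trans _ (root4_ge1 j)). Qed.

(** Convergence of the series of j^(-5/4), by comparison with the telescoping
    differences of j^(-1/4). *)
Lemma sum_root4V5 n : \sum_(j < n) (w j ^+ 5)^-1 <= 5.
Proof.
suff H : \sum_(j < n.+1) (w j ^+ 5)^-1 <= 5 - 4 / w n.
  apply: (@le_trans _ _ (\sum_(j < n.+1) (w j ^+ 5)^-1)).
    by rewrite big_ord_recr/= lerDl invr_ge0 exprn_ge0// ltW.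
  by apply: (le_trans H); rewrite gerBl mulr_ge0// invr_ge0 ltW.
elim: n => [|n IHn].
  by rewrite big_ord1 /root4 !sqrtr1 expr1n invr1; lra.
rewrite big_ord_recr/=; apply: (le_trans (lerD IHn (lexx _))).
rewrite addrAC -addrA lerD2l.
suff : (w n.+1 ^+ 5)^-1 <= 4 / w n - 4 / w n.+1 by lra.
set u := w n; set v := w n.+1.
have u0 : 0 < u by exact: w_gt0.
have v0 : 0 < v by exact: w_gt0.
have uv4 : v ^+ 4 = u ^+ 4 + 1 by rewrite !root4_exp4 natr1.
have uv : u <= v by rewrite -(@ler_pXn2r _ 4)// ?nnegrE ?(ltW u0) ?(ltW v0)//
  uv4 lerDl.
have uvE : (v - u) * ((v + u) * (v ^+ 2 + u ^+ 2)) = 1.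
  have -> : 1 = v ^+ 4 - u ^+ 4 by rewrite uv4 addrAC subrr add0r.
  ring.
have -> : 4 / u - 4 / v = 4 * (v - u) / (u * v) by field; rewrite ?gt_eqF.
rewrite ler_pdivlMr ?mulr_gt0// mulrC ler_pdivrMr ?exprn_gt0//.
have uv2 : u ^+ 2 <= v ^+ 2 by rewrite ler_pXn2r// nnegrE ltW.
have h1 : (v + u) * (v ^+ 2 + u ^+ 2) <= 4 * v ^+ 3.
  have -> : 4 * v ^+ 3 = (2 * v) * (2 * v ^+ 2) by ring.
  by apply: ler_pM; [lra|rewrite addr_ge0 ?sqr_ge0|lra|lra].
have h2 : 1 <= (v - u) * (4 * v ^+ 3).
  by rewrite -[leLHS]uvE ler_wpM2l ?subr_ge0.
have h3 : u * v <= v ^+ 2 by rewrite expr2 ler_pM2r.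
apply: (le_trans h3); have v2 : 0 <= v ^+ 2 by rewrite sqr_ge0.
have -> : 4 * (v - u) * v ^+ 5 = v ^+ 2 * ((v - u) * (4 * v ^+ 3)) by ring.
by rewrite ler_peMr.
Qed.

Lemma scale_gt j : b ^+ j.+1 < (scale j)%:R.
Proof. exact: truncnS_gt. Qed.

Lemma scale_le j : (scale j)%:R <= b ^+ j.+1 + 1.
Proof.
rewrite /scale -natr1 lerD2r truncn_le exprn_ge0// (le_trans _ (ltW b_gt1))//.
Qed.

Let N_gt1 j : 1 < (scale j)%:R :> R.
Proof. by apply: (lt_trans _ (scale_gt j)); rewrite exprn_egt1. Qed.

Let N_gt0 j : 0 < (scale j)%:R :> R.
Proof. by rewrite (lt_trans _ (N_gt1 j)). Qed.

Lemma level_gt0 j : 0 < level j.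
Proof. by rewrite invr_gt0 mulr_gt0// exprn_gt0. Qed.

Lemma level_lt1 j : level j < 1.
Proof.
rewrite invf_lt1 ?mulr_gt0 ?exprn_gt0// (lt_le_trans (N_gt1 j))//.
by rewrite ler_peMl// ?exprn_ege1 ?root4_ge1// ltW.
Qed.

(** The two obstructions at time N = scale j: the relative deviation of the
    truncated sum from its mean, and the pairs of visits below the level. *)
Definition scale_error (j : nat) (z : T) : R :=
  ((cutoff_sum (level j) (scale j) z - (scale j)%:R * ln (level j)^-1)
     / ((scale j)%:R * j.+1%:R)) ^+ 2 + close_pairs (level j) (scale j) z.

Lemma scale_error_ge0 j z : 0 <= scale_error j z.
Proof. by rewrite addr_ge0 ?sqr_ge0 ?close_pairs_ge0. Qed.

Lemma measurable_scale_error j : measurable_fun [set: T] (scale_error j).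
Proof.
apply: measurable_funD; last exact: measurable_close_pairs.
apply: measurable_funX; apply: measurable_funM => //;
  apply: measurable_funB => //.
apply: measurable_cutoff_sum; exact: level_gt0.
Qed.

Lemma expectation_scale_error j :
  (\int[P]_z (scale_error j z)%:E <= (2 / w j ^+ 5)%:E)%E.
Proof.
have d0 := level_gt0 j; have d1 := level_lt1 j; have w0 := w_gt0 j.
have mY := measurable_cutoff_sum (scale j) d0.
have mYM : measurable_fun [set: T] (fun z =>
    (cutoff_sum (level j) (scale j) z - (scale j)%:R * ln (level j)^-1) ^+ 2).
  by apply: measurable_funX; exact: measurable_funB.
under eq_integral do rewrite EFinD.
rewrite ge0_integralD//; last 4 first.
- by move=> z _; rewrite lee_fin sqr_ge0.
- apply/measurable_EFinP; apply: measurable_funX; apply: measurable_funM => //.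
  exact: measurable_funB.
- by move=> z _; rewrite lee_fin close_pairs_ge0.
- by apply/measurable_EFinP; exact: measurable_close_pairs.
have -> : (2 / w j ^+ 5)%:E = ((w j ^+ 5)^-1%:E + (w j ^+ 5)^-1%:E)%E.
  by rewrite -EFinD; congr (_%:E); field; rewrite gt_eqF.
apply: leeD.
- set c := ((scale j)%:R * j.+1%:R : R).
  have c0 : 0 < c by rewrite mulr_gt0.
  under eq_integral do rewrite expr_div_n mulrC EFinM.
  rewrite ge0_integralZl//; last 3 first.
  + exact/measurable_EFinP.
  + by move=> z _; rewrite lee_fin sqr_ge0.
  + by rewrite lee_fin invr_ge0 sqr_ge0.
  apply: (@le_trans _ _ ((c ^+ 2)^-1%:E * ((scale j)%:R / level j)%:E)%E).
    apply: lee_wpmul2l; first by rewrite lee_fin invr_ge0 sqr_ge0.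
    exact: cutoff_sum_variance.
  rewrite -EFinM lee_fin /c /level invrK -root4_exp4.
  have N0 := N_gt0 j.
  rewrite le_eqVlt; apply/orP; left; apply/eqP; field.
  by rewrite !gt_eqF.
- apply: (le_trans (close_pairs_expectation _ d0 d1)).
  have -> : (scale j)%:R * level j = (w j ^+ 3)^-1.
    have N0 := N_gt0 j; rewrite /level; field.
    by rewrite !gt_eqF.
  rewrite lee_fin -exprVn -exprM exprVn lef_pV2 ?posrE ?exprn_gt0//.
  by rewrite ler_weXn2l ?root4_ge1.
Qed.

Lemma scale_error_ae : {ae mu, forall a, 0 <= a < 1 ->
  {ae mu, forall x, 0 <= x < 1 -> scale_error ^~ (a, x) @ \oo --> (0 : R)}}.
Proof.
apply: summable_expectation_ae_cvg0.
- exact: measurable_scale_error.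
- exact: scale_error_ge0.
apply: (@le_lt_trans _ _ 10%:E); last exact: ltry.
apply: lime_le.
  by apply: is_cvg_nneseries => j _ _; apply: integral_ge0 => z _;
    rewrite lee_fin scale_error_ge0.
apply: nearW => n; rewrite big_mkord.
apply: (@le_trans _ _ (\sum_(j < n) (2 / w j ^+ 5)%:E)%E).
  by apply: lee_sum => j _; exact: expectation_scale_error.
rewrite sumEFin lee_fin -mulr_sumr.
have := sum_root4V5 n; lra.
Qed.

End GeometricScale.

Section ScaleLimit.
Context {R : realType}.
Variable b : R.
Hypothesis b_gt1 : 1 < b.

Lemma close_pairs_lt1 (d : R) N z : close_pairs d N z < 1 ->
  forall m n : 'I_N, orbit_point m z < d -> orbit_point n z < d -> m = n.
Proof.
move=> lt1; suff H (m n : 'I_N) : (m < n)%N ->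
    orbit_point m z < d -> orbit_point n z < d -> False.
  move=> m n md nd; case: (ltngtP m n) => mn; last exact: val_inj.
    by case: (H m n mn md nd).
  by case: (H n m mn nd md).
move=> mn md nd; move: lt1; rewrite ltNge => /negP; apply.
rewrite /close_pairs (bigD1 n)//= (bigD1 m)//= mn md nd mulr1 -addrA lerDl
  addr_ge0//.
  by apply: sumr_ge0 => i _; case: ifP => // _; rewrite mulr_ge0.
by apply: sumr_ge0 => i _; apply: sumr_ge0 => k _; case: ifP => // _;
  rewrite mulr_ge0.
Qed.

Lemma ln_scale j : j.+1%:R * ln b <= ln (scale b j)%:R <= j.+1%:R * ln b + 1.
Proof.
have b0 : 0 < b by exact: lt_trans b_gt1.
have bj0 : 0 < b ^+ j.+1 by exact: exprn_gt0.
have N0 : 0 < (scale b j)%:R :> R by rewrite (lt_trans bj0)// scale_gt.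
rewrite mulr_natl -lnXn//; apply/andP; split.
  by rewrite ler_ln ?posrE// ltW// scale_gt.
rewrite -lerBlDl -ln_div ?posrE// (le_trans (ln_le_subr1 _)) ?divr_gt0//.
rewrite lerBlDr ler_pdivrMr// (le_trans (scale_le _ _))//.
have b1 : 1 <= b ^+ j.+1 by rewrite exprn_ege1// ltW.
lra.
Qed.

Lemma ln_levelV j : j.+1%:R * ln b <= ln (level b j)^-1 <=
  j.+1%:R * ln b + 4 * (root4 j : R).
Proof.
have w0 : 0 < (root4 j : R) by rewrite (lt_le_trans _ (@root4_ge1 R j)).
have N0 : 0 < (scale b j)%:R :> R by rewrite ltr0n.
rewrite /level invrK lnM ?posrE ?exprn_gt0// lnXn//.
have /andP[N1 N2] := ln_scale j.
have lw0 : 0 <= ln (root4 j : R) by rewrite ln_ge0 ?root4_ge1.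
have lw := ltW (ln_sublinear w0); have w1 := @root4_ge1 R j.
rewrite -[ln _ *+ 3]mulr_natl; apply/andP; split; lra.
Qed.

Lemma scale_error_trimmed (a x : R) (e : R) : 0 < e ->
  scale_error b ^~ (a, x) @ \oo --> (0 : R) ->
  \forall j \near \oo,
    `|trimmed (fun n => (orbit_point n (a, x))^-1) (scale b j)
      - (scale b j)%:R * (j.+1%:R * ln b)| <=
        6 * e * ((scale b j)%:R * j.+1%:R).
Proof.
move=> e0 cvg; near=> j.
set z := (a, x); set N := scale b j; set w := (root4 j : R); set d := level b j.
set J := (j.+1%:R : R).
have w1 : 1 <= w := @root4_ge1 R j.
have w0 : 0 < w by exact: lt_le_trans w1.
have J0 : 0 < J by rewrite ltr0n.
have N0 : 0 < N%:R :> R by rewrite ltr0n.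
have d0 : 0 < d := level_gt0 b_gt1 j.
have ew : 1 <= e * w.
  rewrite -ler_pdivrMl// mulr1 -(@ler_pXn2r _ 4)// ?nnegrE ?invr_ge0 ?ltW//.
  apply: (@lt_le_trans _ _ j%:R); last by rewrite root4_exp4 ler_nat.
  by near: j; exact: nbhs_infty_gtr.
have err : scale_error b j z < Num.min 1 (e ^+ 2).
  rewrite (le_lt_trans (ler_norm _))//; near: j.
  by apply: cvgr0_norm_lt => //; rewrite lt_min ltr01 exprn_gt0.
set D := cutoff_sum d N z - N%:R * ln d^-1.
have pairs0 : 0 <= close_pairs d N z by exact: close_pairs_ge0.
move: err; rewrite lt_min => /andP[err1 erre].
have pairs1 : close_pairs d N z < 1.
  by rewrite (le_lt_trans _ err1)// /scale_error lerDr sqr_ge0.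
have D_le : `|D| <= e * (N%:R * J).
  rewrite -ler_pdivrMr ?mulr_gt0//.
  have -> : `|D| / (N%:R * J) = `|D / (N%:R * J)|.
    by rewrite normf_div [`|N%:R * J|]ger0_norm// ltW// mulr_gt0.
  rewrite -(@ler_pXn2r _ 2)// ?nnegrE ?ltW// real_normK ?num_real//.
  by rewrite (le_lt_trans _ erre)// /scale_error lerDl.
have [T1 T2] : cutoff_sum d N z - d^-1 <=
  trimmed (fun n => (orbit_point n z)^-1) N /\
    trimmed (fun n => (orbit_point n z)^-1) N <= cutoff_sum d N z.
  apply/andP; apply: trimmed_cutoff_bounds => //; first by move=> n;
    exact: frac_ge0.
  exact: close_pairs_lt1.
have /andP[L1 L2] := ln_levelV j.
(* as e w >= 1, both w^3 and w are small compared with J = w^4 *)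
have JE : J = w ^+ 4 by rewrite root4_exp4.
have dV : d^-1 <= e * (N%:R * J).
  have -> : e * (N%:R * J) = (w ^+ 3 * N%:R) * (e * w) by rewrite JE; ring.
  by rewrite /d /level invrK ler_peMr// mulr_ge0// exprn_ge0// ltW.
have wJ : 4 * w <= 4 * e * J.
  have -> : 4 * e * J = 4 * w * (w ^+ 2 * (e * w)) by rewrite JE; ring.
  by rewrite ler_peMr ?mulr_ge0 ?(ltW w0)// mulr_ege1// exprn_ege1.
have NL1 : N%:R * (J * ln b) <= N%:R * ln d^-1 by rewrite ler_wpM2l.
have NL2 : N%:R * ln d^-1 <= N%:R * (J * ln b) + 4 * e * (N%:R * J).
  have -> : 4 * e * (N%:R * J) = N%:R * (4 * e * J) by ring.
  by rewrite -mulrDr ler_wpM2l// (le_trans L2)// lerD2l.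
move: D_le; rewrite ler_norml => /andP[D1 D2].
have eNJ : 0 <= e * (N%:R * J) by rewrite !mulr_ge0// ltW.
rewrite -/z -/N ler_norml; move: D1 D2; rewrite /D => D1 D2; apply/andP; split;
  lra.
Unshelve. all: by end_near.
Qed.

End ScaleLimit.

(** * From geometric times to all times *)

Section Interpolation.
Context {R : realType}.
Variable b : R.
Hypothesis b_gt1 : 1 < b.

Lemma scale_homo : {homo scale b : i j / (i <= j)%N}.
Proof. by move=> i j ij; rewrite ltnS le_truncn// ler_weXn2l// ltW. Qed.

Lemma scale_linear j : j%:R * (b - 1) < (scale b j)%:R.
Proof.
apply: le_lt_trans (scale_gt b j).
suff H n : 1 + n%:R * (b - 1) <= b ^+ n.
  by apply: le_trans (H j.+1); rewrite -natr1 mulrDl; move: b_gt1; lra.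
elim: n => [|n IHn]; first by rewrite mul0r addr0.
rewrite exprS; apply: (@le_trans _ _ (b * (1 + n%:R * (b - 1)))); last first.
  by rewrite ler_wpM2l// ltW// (lt_trans _ b_gt1).
have : 0 <= n%:R * (b - 1) * (b - 1) :> R
  by rewrite -mulrA mulr_ge0// -expr2 sqr_ge0.
by rewrite -natr1; lra.
Qed.

(** Every large time N lies in a window [scale j, scale (j + 1)[ with j large,
    although some windows may be empty. *)
Lemma near_scale (Q : nat -> Prop) : (\forall j \near \oo, Q j) ->
  \forall N \near \oo, exists j, Q j /\ (scale b j <= N < scale b j.+1)%N.
Proof.
move=> [J _ QJ]; exists (scale b J) => // N /= JN.
have ex : exists k, (N < scale b k)%N.
  exists (Num.truncn (N%:R / (b - 1))).+1.
  rewrite -(ltr_nat R); apply: lt_trans (scale_linear _).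
  by rewrite -ltr_pdivrMr ?subr_gt0// truncnS_gt.
case: (ex_minnP ex) => -[|k] Nk kmin.
  by move: (leq_ltn_trans JN Nk); rewrite ltnNge scale_homo.
have kN : (scale b k <= N)%N by rewrite leqNgt; apply/negP => /kmin;
  rewrite ltnn.
exists k; rewrite kN Nk; split => //; apply: QJ => /=.
rewrite leqNgt; apply/negP => kJ.
by move: (leq_ltn_trans JN Nk); rewrite ltnNge scale_homo.
Qed.

Lemma near_scaleS : \forall j \near \oo, (scale b j.+1)%:R <=
  b ^+ 2 * (scale b j)%:R.
Proof.
have b0 : 0 < b by exact: lt_trans b_gt1.
have b2 : 0 < b * (b - 1) by rewrite mulr_gt0// subr_gt0.
near=> j.
have jb : (b * (b - 1) * (b - 1))^-1 <= j%:R.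
  by near: j; exact: nbhs_infty_ger.
have H1 : 1 <= b * (b - 1) * (scale b j)%:R.
  rewrite -ler_pdivrMl// mulr1; apply: ltW; apply: le_lt_trans (scale_linear j).
  by rewrite -ler_pdivrMr ?subr_gt0// -invfM.
apply: (le_trans (scale_le b_gt1 _)).
have H2 : b ^+ j.+2 <= b * (scale b j)%:R.
  by rewrite exprS ler_wpM2l ?(ltW b0)// ltW// scale_gt.
apply: (le_trans (lerD H2 H1)).
by rewrite -mulrDl addrC mulrBr mulr1 subrK -expr2.
Unshelve. all: by end_near.
Qed.

(** Over a window, the time grows by a factor at most b^2 and its logarithm by
    a bounded amount. *)
Lemma homo_scale_asymptotics (T : nat -> R) :
    {homo T : m n / (m <= n)%N >-> m <= n} ->
    (forall e, 0 < e -> \forall j \near \oo,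
      `|T (scale b j) - (scale b j)%:R * (j.+1%:R * ln b)| <=
      e * ((scale b j)%:R * j.+1%:R)) ->
  forall e, 0 < e < 1 -> \forall N \near \oo,
    (1 - e) ^+ 2 / b ^+ 2 * (N%:R * ln N%:R) <= T N <=
    (1 + e) ^+ 2 * b ^+ 2 * (N%:R * ln N%:R).
Proof.
move=> Thomo Tscale e /andP[e0 e1].
set l := ln b; have l0 : 0 < l by exact: ln_gt0.
have b0 : 0 < b by exact: lt_trans b_gt1.
have Te : \forall j \near \oo,
    `|T (scale b j) - (scale b j)%:R * (j.+1%:R * l)| <=
    e * ((scale b j)%:R * (j.+1%:R * l)).
  near=> j; have -> : e * ((scale b j)%:R * (j.+1%:R * l)) =
    e * l * ((scale b j)%:R * j.+1%:R).
    ring.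
  by near: j; apply: Tscale; rewrite mulr_gt0.
have TeS : \forall j \near \oo,
    `|T (scale b j.+1) - (scale b j.+1)%:R * (j.+2%:R * l)| <=
    e * ((scale b j.+1)%:R * (j.+2%:R * l)).
  by case: Te => J _ HJ; exists J => // j /= Jj; apply: HJ => /=; rewrite leqW.
near=> N.
have [j [[[Tj TSj] Nb] /andP[jN NSj]]] : exists j,
  ((`|T (scale b j) - (scale b j)%:R * (j.+1%:R * l)| <=
    e * ((scale b j)%:R * (j.+1%:R * l)) /\
    `|T (scale b j.+1) - (scale b j.+1)%:R * (j.+2%:R * l)| <=
    e * ((scale b j.+1)%:R * (j.+2%:R * l))) /\
    (scale b j.+1)%:R <= b ^+ 2 * (scale b j)%:R) /\
  (scale b j <= N < scale b j.+1)%N.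
  near: N; apply: near_scale; near=> j; split; first split.
  - by near: j; exact: Te.
  - by near: j; exact: TeS.
  - by near: j; exact: near_scaleS.
have lN_gt : (l + 1) / e <= ln N%:R.
  have : expR ((l + 1) / e) <= N%:R by near: N; exact: nbhs_infty_ger.
  move=> H; apply: (@le_trans _ _ (ln (expR ((l + 1) / e))));
    first by rewrite expRK.
  by rewrite ler_ln ?posrE ?expR_gt0// (lt_le_trans (expR_gt0 _) H).
have le_N : l + 1 <= e * ln N%:R by rewrite mulrC -ler_pdivrMr.
have N0 : 0 < N%:R :> R by rewrite ltr0n (leq_trans _ jN).
have /andP[L1 L2] := ln_scale b_gt1 j.
have /andP[LS1 LS2] := ln_scale b_gt1 j.+1.
have jNr : (scale b j)%:R <= N%:R :> R by rewrite ler_nat.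
have NSjr : N%:R <= (scale b j.+1)%:R :> R by rewrite ler_nat ltnW.
have lnj : ln (scale b j)%:R <= ln N%:R :> R by rewrite ler_ln// posrE ltr0n.
have lnSj : ln N%:R <= ln (scale b j.+1)%:R :> R
  by rewrite ler_ln// posrE ltr0n.
move: Tj TSj; rewrite !ler_norml => /andP[Tj _] /andP[_ TSj].
have b2 : 0 < b ^+ 2 by rewrite exprn_gt0.
rewrite -/l in L1 L2 LS1 LS2.
have ln0 : 0 < ln N%:R :> R by apply: lt_le_trans lN_gt;
  rewrite divr_gt0// addr_gt0.
apply/andP; split.
- apply: le_trans (Thomo _ _ jN).
  apply: (@le_trans _ _ ((1 - e) * ((scale b j)%:R * (j.+1%:R * l))));
    last by lra.
  have -> : (1 - e) ^+ 2 / b ^+ 2 * (N%:R * ln N%:R) =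
      (1 - e) * ((N%:R / b ^+ 2) * ((1 - e) * ln N%:R)).
    by field; rewrite gt_eqF.
  rewrite ler_wpM2l ?subr_ge0 ?(ltW e1)//; apply: ler_pM.
  + by rewrite divr_ge0// ltW.
  + by rewrite mulr_ge0 ?subr_ge0// ltW.
  + by rewrite ler_pdivrMr// (le_trans NSjr)// mulrC.
  + by move: LS2; rewrite -natr1; lra.
- apply: (le_trans (Thomo _ _ (ltnW NSj))).
  apply: (@le_trans _ _ ((1 + e) * ((scale b j.+1)%:R * (j.+2%:R * l))));
    first by lra.
  have -> : (1 + e) ^+ 2 * b ^+ 2 * (N%:R * ln N%:R) =
      (1 + e) * ((b ^+ 2 * N%:R) * ((1 + e) * ln N%:R)) by ring.
  rewrite ler_wpM2l//; first by rewrite addr_ge0// ltW.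
  apply: ler_pM => //.
  + by rewrite mulr_ge0// ltW.
  + by rewrite (le_trans Nb)// ler_wpM2l// ltW.
  + by rewrite -natr1; lra.
Unshelve. all: by end_near.
Qed.

End Interpolation.

Section AlmostEveryRotation.
Context {R : realType}.
Local Notation mu := (@lebesgue_measure R).

Let ratio (r : nat) : R := 1 + r.+2%:R^-1.

Let ratio_gt1 r : 1 < ratio r.
Proof. by rewrite ltrDl invr_gt0. Qed.

Lemma scale_errors_cvg1 (a x : R) : 0 <= x < 1 ->
  (forall r, scale_error (ratio r) ^~ (a, x) @ \oo --> (0 : R)) ->
  (fun N : nat => trimmed_sum a recip N x / (N%:R * ln N%:R)) @ \oo --> (1 : R).
Proof.
move=> x01 err0; apply/cvgrPdist_le => eps eps0.
pose r := Num.truncn (15 / eps); pose e : R := r.+2%:R^-1.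
have e0 : 0 < e by rewrite invr_gt0.
have e1 : e < 1 by rewrite invf_lt1// ltr1n.
have e0' := ltW e0; have e1' := ltW e1.
have ee : 15 * e <= eps.
  rewrite ler_pdivrMr// mulrC -ler_pdivrMr//.
  by rewrite (le_trans (ltW (truncnS_gt _)))// ler_nat.
(* (1 + e)^4 <= 1 + 15 e and (1 - e)^2 / (1 + e)^2 >= 1 - 15 e on ]0, 1[ *)
have upper : (1 + e) ^+ 2 * (ratio r) ^+ 2 <= 1 + eps.
  rewrite /ratio -/e -exprMn; apply: le_trans (lerD (lexx 1) ee).
  have e2 : 0 <= e * (1 - e) by rewrite mulr_ge0 ?subr_ge0.
  have e3 : 0 <= e * e * (1 - e) by rewrite !mulr_ge0 ?subr_ge0.
  have e4 : 0 <= e * e * e * (1 - e) by rewrite !mulr_ge0 ?subr_ge0.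
  lra.
have lower : 1 - eps <= (1 - e) ^+ 2 / (ratio r) ^+ 2.
  rewrite /ratio -/e ler_pdivlMr ?exprn_gt0 ?addr_gt0//.
  have h : 0 <= (eps - 15 * e) * (1 + e) ^+ 2
    by rewrite mulr_ge0 ?sqr_ge0// subr_ge0.
  have e2 : 0 <= e * e by rewrite mulr_ge0.
  have e3 : 0 <= e * e * e by rewrite !mulr_ge0.
  lra.
have u0 n : 0 <= (frac (x + n%:R * a))^-1 by rewrite invr_ge0 frac_ge0.
have asym := @homo_scale_asymptotics _ _ (ratio_gt1 r) _ (trimmed_homo u0).
near=> N.
have N1 : (1 < N)%N by near: N; exists 2%N.
have NlN : 0 < N%:R * ln N%:R :> R
  by rewrite mulr_gt0 ?ln_gt0 ?ltr1n// ltr0n ltnW.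
have : (1 - e) ^+ 2 / ratio r ^+ 2 * (N%:R * ln N%:R) <=
    trimmed (fun n => (frac (x + n%:R * a))^-1) N <=
    (1 + e) ^+ 2 * ratio r ^+ 2 * (N%:R * ln N%:R).
  near: N; apply: asym; last by rewrite e0.
  move=> d d0; have d6 : d = 6 * (d / 6) by field.
  rewrite d6; apply: (scale_error_trimmed (ratio_gt1 r)) => //.
  by rewrite divr_gt0.
rewrite -trimmed_sumE// => /andP[lo up].
have t_le : trimmed_sum a recip N x / (N%:R * ln N%:R) <= 1 + eps.
  by rewrite ler_pdivrMr//; apply: (le_trans up); rewrite ler_wpM2r// ltW.
have t_ge : 1 - eps <= trimmed_sum a recip N x / (N%:R * ln N%:R).
  by rewrite ler_pdivlMr//; apply: le_trans lo; rewrite ler_wpM2r// ltW.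
by rewrite ler_norml; apply/andP; split; lra.
Unshelve. all: by end_near.
Qed.

Lemma ae_trimmed_sum_cvg1 :
  {ae mu, forall alpha : R, 0 < alpha < 1 -> {ae mu, forall x : R, 0 <= x < 1 ->
    (fun N : nat => trimmed_sum alpha recip N x / (N%:R * ln N%:R)) @ \oo -->
      (1 : R)}}.
Proof.
apply: filterS (ae_foralln (fun r => scale_error_ae (ratio_gt1 r))) =>
  a err_a /andP[a0 a1].
have {}err_a r := err_a r (introT andP (conj (ltW a0) a1)).
apply: filterS (ae_foralln err_a) => x err_x x01;
  apply: scale_errors_cvg1 => // r.
exact: err_x.
Qed.

End AlmostEveryRotation.

(** * Bounded type and badly approximable numbers *)

Section BadlyApproximable.
Context {R : realType}.
Implicit Types (alpha t : R).

Lemma irrational_inv_sub alpha (m : nat) : irrational alpha ->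
  irrational (alpha^-1 - m%:R).
Proof.
move=> irr [s _ sE]; apply: irr; exists (s + m%:R)^-1 => //.
by rewrite fmorphV rmorphD/= ratr_nat sE subrK invrK.
Qed.

Lemma irrational_neq0 alpha : irrational alpha -> alpha != 0.
Proof.
by move=> irr; apply/eqP => a0; apply: irr; exists 0 => //; rewrite rmorph0.
Qed.

Lemma gauss_mapE alpha : 0 < alpha ->
  gauss_map alpha = alpha^-1 - (cf_digit alpha 0)%:R.
Proof.
move=> a0; rewrite /gauss_map /Defs.frac /cf_digit /= truncn_floor.
by rewrite invr_ge0 ltW// natr_absz ger0_norm// floor_ge0 invr_ge0 ltW.
Qed.

Lemma cf_digitS alpha n : cf_digit alpha n.+1 = cf_digit (gauss_map alpha) n.
Proof. by rewrite /cf_digit iterSr. Qed.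

(** The form (q + p t) |q alpha - p| / (1 + alpha t) is invariant under one
    step of the Euclidean algorithm, where a = [1/alpha], (q, p) becomes
    (p, q - p a), alpha becomes 1/alpha - a and t becomes 1 / (a + t): this is
    the natural extension of the Gauss map.  The descent stops when p = 0 or
    q < p a, where the crude bound alpha > 1 / (M + 1) is enough.  The
    parameter s bounds the length of the descent. *)
Lemma badly_approximable_form (M : nat) (s : nat) alpha t (q p : nat) :
  (q + p <= s)%N -> 0 < alpha < 1 -> irrational alpha ->
  (forall n, (cf_digit alpha n <= M)%N) -> 0 <= t <= 1 -> (0 < q)%N ->
  (1 + alpha * t) / (2 * M.+1%:R) <= (q%:R + p%:R * t) * `|q%:R * alpha - p%:R|.
Proof.
elim: s alpha t q p => [|s IHs] alpha t q p.
  by rewrite leqn0 addn_eq0 => /andP[/eqP ->].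
move=> qps a01 irr digits t01 q0.
have [[a0 a1] [t0 t1]] : (0 < alpha /\ alpha < 1) /\ (0 <= t /\ t <= 1).
  by split; apply/andP.
set a := cf_digit alpha 0.
have aV : alpha^-1 < M.+1%:R.
  by rewrite (lt_le_trans (truncnS_gt _))// ler_nat ltnS (digits 0).
have q1 : 1 <= q%:R :> R by rewrite ler1n.
have M0 : 0 < M.+1%:R :> R by rewrite ltr0n.
(* as alpha > 1 / (M + 1), this crude bound settles the end of the descent *)
have enough : alpha <= (q%:R + p%:R * t) * `|q%:R * alpha - p%:R| ->
    (1 + alpha * t) / (2 * M.+1%:R) <= (q%:R + p%:R * t) * `|q%:R * alpha -
      p%:R|.
  apply: le_trans; rewrite ler_pdivrMr ?mulr_gt0//.
  have aM : 1 <= alpha * M.+1%:R by rewrite -ler_pdivrMl// mulr1 ltW.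
  have at1 : alpha * t <= 1 by rewrite mulr_ile1// ltW.
  lra.
have qpt1 : 1 <= q%:R + p%:R * t.
  by rewrite (le_trans q1)// lerDl mulr_ge0.
have [p0|p_gt0] := posnP p.
  apply: enough; rewrite p0 mul0r addr0 subr0 ger0_norm ?mulr_ge0// ?(ltW a0)//.
  by rewrite mulrA ler_peMl ?mulr_ege1// ltW.
have a_ge1 : (1 <= a)%N by rewrite /a /cf_digit /= truncn_gt0 invf_ge1// ltW.
set beta := gauss_map alpha.
have betaE : beta = alpha^-1 - a%:R by exact: gauss_mapE.
have irrb : irrational beta by rewrite betaE; exact: irrational_inv_sub.
have b01 : 0 < beta < 1.
  by rewrite lt0r irrational_neq0//= frac_ge0 frac_lt1.
have [b0 b1] : 0 < beta /\ beta < 1 by apply/andP.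
have alphaE : alpha = (a%:R + beta)^-1 by rewrite betaE addrC subrK invrK.
have form : q%:R * alpha - p%:R = alpha * (q%:R - (p * a)%:R - p%:R * beta).
  by rewrite betaE natrM; field; rewrite gt_eqF.
have [qpa|paq] := ltnP q (p * a).
  apply: enough; rewrite form normrM gtr0_norm//.
  have n1 : 1 <= `|q%:R - (p * a)%:R - p%:R * beta|.
    rewrite -normrN; apply: le_trans (ler_norm _).
    have : 0 <= p%:R * beta by rewrite mulr_ge0// ltW.
    have : q%:R + 1 <= (p * a)%:R :> R by rewrite natr1 ler_nat.
    lra.
  by rewrite mulrCA ler_peMr ?mulr_ege1// ltW.
have t'01 : 0 <= (a%:R + t)^-1 <= 1.
  have at1 : 1 <= a%:R + t by rewrite (@le_trans _ _ a%:R)// ?ler1n// lerDl.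
  by rewrite invr_ge0 (le_trans _ at1)//= invf_le1// (lt_le_trans _ at1).
have digitsb n : (cf_digit beta n <= M)%N by rewrite -cf_digitS.
have sz : (p + (q - p * a) <= s)%N.
  have := leq_mul (leqnn p) a_ge1; rewrite muln1.
  move: (p * a)%N paq qps p_gt0 => pa; clear; lia.
have := IHs beta _ p _ sz b01 irrb digitsb t'01 p_gt0.
have -> : `|q%:R * alpha - p%:R| = alpha * `|p%:R * beta - (q - p * a)%:R|.
  rewrite form normrM gtr0_norm// natrB// -normrN.
  by congr (_ * `|_|); ring.
have a_pos : 0 < a%:R :> R by rewrite ltr0n.
have at0 : 0 < a%:R + t by rewrite ltr_wpDr.
have ab0 : 0 < a%:R + beta by rewrite addr_gt0.
set X := `| _ |.
have -> : (q%:R + p%:R * t) * (alpha * X) =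
    (a%:R + t) / (a%:R + beta) * ((p%:R + (q - p * a)%:R / (a%:R + t)) * X).
  by rewrite alphaE natrB// natrM; field; rewrite !gt_eqF.
have -> : (1 + alpha * t) / (2 * M.+1%:R) =
    (a%:R + t) / (a%:R + beta) * ((1 + beta / (a%:R + t)) / (2 * M.+1%:R)).
  by rewrite alphaE; field; rewrite !gt_eqF.
by move=> IH; rewrite ler_wpM2l// divr_ge0// ltW.
Qed.

Lemma bounded_type_badly_approximable alpha : 0 < alpha < 1 ->
    irrational alpha -> bounded_type alpha ->
  exists2 c : R, 0 < c <= 1 & forall (q : nat) (p : int), (0 < q)%N ->
    c / q%:R <= `|q%:R * alpha - p%:~R|.
Proof.
move=> a01 irr [M digits]; have /andP[a0 a1] := a01.
have M0 : 1 <= 2 * M.+1%:R :> R by rewrite -natrM ler1n.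
have M1 : 0 < 2 * M.+1%:R :> R by rewrite (lt_le_trans _ M0).
exists (2 * M.+1%:R)^-1; first by rewrite invr_gt0 M1 invf_le1.
move=> q p q0; have q1 : 1 <= q%:R :> R by rewrite ler1n.
have q0' : 0 < q%:R :> R by rewrite ltr0n.
rewrite ler_pdivrMr// [leRHS]mulrC; case: p => p.
  have := @badly_approximable_form M (q + p) alpha 0 q p (leqnn _) a01 irr
    digits.
  by rewrite !mulr0 !addr0 div1r; apply => //; rewrite lexx ler01.
apply: (@le_trans _ _ 1); first by rewrite invf_le1.
rewrite mulr_ege1// (le_trans _ (ler_norm _))// NegzE mulrNz opprK.
have : 0 <= q%:R * alpha by rewrite mulr_ge0 ?ltW.
have : 1 <= p.+1%:R :> R by rewrite ler1n.
rewrite -pmulrn; lra.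
Qed.

End BadlyApproximable.

Section DiophantineOrbits.
Context {R : realType}.
Implicit Types (alpha x : R).

Lemma orbit_separated (c alpha x : R) (N m n : nat) : 0 < c ->
    (forall (q : nat) (p : int), (0 < q)%N -> c / q%:R <=
      `|q%:R * alpha - p%:~R|) ->
    (m < N)%N -> (n < N)%N -> m != n ->
  c / N%:R <= `|frac (x + m%:R * alpha) - frac (x + n%:R * alpha)|.
Proof.
move=> c0 bad; wlog mn : m n / (n < m)%N => [wl mN nN mn|mN _ _].
  have [nm|nm|] := ltngtP n m;
    [exact: wl| |by move=> nm; rewrite nm eqxx in mn].
  by rewrite distrC; apply: wl => //; rewrite eq_sym.
have mn0 : (0 < m - n)%N by rewrite subn_gt0.
have := bad (m - n)%N
  (Num.floor (x + m%:R * alpha) - Num.floor (x + n%:R * alpha)) mn0.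
have -> : (m - n)%:R * alpha -
  (Num.floor (x + m%:R * alpha) - Num.floor (x + n%:R * alpha))%:~R =
    frac (x + m%:R * alpha) - frac (x + n%:R * alpha).
  by rewrite /Defs.frac natrB ?intrB 1?ltnW//; ring.
apply: le_trans; rewrite ler_wpM2l ?(ltW c0)// lef_pV2 ?posrE ?ltr0n//
  ?(leq_trans _ mN)//.
by rewrite ler_nat (leq_trans (leq_subr _ _))// ltnW.
Qed.

(** Pigeonhole principle; dividing q and p by their gcd only improves the
    approximation. *)
Lemma dirichlet_coprime alpha (Q : nat) : 0 <= alpha -> (0 < Q)%N ->
  exists q p : nat, [/\ (0 < q <= Q)%N, coprime q p & `|q%:R * alpha -
    p%:R| < Q%:R^-1].
Proof.
move=> a0 Q0; have Q0' : 0 < Q%:R :> R by rewrite ltr0n.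
have cellP (n : 'I_Q.+1) : (Num.truncn (Q%:R * frac (n%:R * alpha)) < Q)%N.
  by rewrite truncn_lt_nat ?mulr_ge0 ?frac_ge0// -[ltRHS]mulr1 ltr_pM2l//
    frac_lt1.
pose cell n := Ordinal (cellP n).
have /injectivePn[m [n mn cellmn]] : ~~ injectiveb cell.
  by apply/injectiveP => /leq_card; rewrite !card_ord ltnn.
wlog nm : m n mn cellmn / (n < m)%N.
  move=> wl; case: (ltngtP n m) => nm; [exact: (wl m n)| |].
    by apply: (wl n m) => //; rewrite eq_sym.
  by move: mn; rewrite (val_inj nm) eqxx.
have [ta tb] : 0 <= Q%:R * frac (m%:R * alpha) /\ 0 <=
  Q%:R * frac (n%:R * alpha).
  by split; rewrite mulr_ge0 ?frac_ge0.
have /andP[m1 m2] := truncn_itv ta; have /andP[n1 n2] := truncn_itv tb.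
have /= cellE := congr1 val cellmn.
have close : `|frac (m%:R * alpha) - frac (n%:R * alpha)| < Q%:R^-1.
  rewrite -(ltr_pM2l Q0') divff ?gt_eqF// -[X in X * _](gtr0_norm Q0') -normrM
    mulrBr.
  by rewrite cellE -!natr1 in m1 m2 n1 n2; rewrite ltr_norml; apply/andP; split;
    lra.
pose d0 := (m - n)%N.
have d0_gt0 : (0 < d0)%N by rewrite subn_gt0.
have floor_mn : (Num.floor (n%:R * alpha) <= Num.floor (m%:R * alpha)).
  by rewrite le_floor// ler_wpM2r// ler_nat ltnW.
pose p0 := `|Num.floor (m%:R * alpha) - Num.floor (n%:R * alpha)|%N.
have p0E : p0%:R = (Num.floor (m%:R * alpha))%:~R -
  (Num.floor (n%:R * alpha))%:~R :> R.
  by rewrite /p0 natr_absz ger0_norm ?subr_ge0// intrB.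
have approx : `|d0%:R * alpha - p0%:R| < Q%:R^-1.
  rewrite p0E natrB ?(ltnW nm)//; apply: le_lt_trans close.
  by rewrite /Defs.frac le_eqVlt; apply/orP; left; apply/eqP; congr (`|_|);
    ring.
have g0 : (0 < gcdn d0 p0)%N by rewrite gcdn_gt0 d0_gt0.
have qE : (d0 %/ gcdn d0 p0 * gcdn d0 p0)%N = d0 by rewrite divnK// dvdn_gcdl.
have pE : (p0 %/ gcdn d0 p0 * gcdn d0 p0)%N = p0 by rewrite divnK// dvdn_gcdr.
exists (d0 %/ gcdn d0 p0)%N, (p0 %/ gcdn d0 p0)%N; split.
- rewrite divn_gt0// dvdn_leq ?dvdn_gcdl//=.
  by rewrite (leq_trans (leq_div _ _))// (leq_trans (leq_subr _ _))// -ltnS.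
- by rewrite /coprime -(eqn_pmul2r g0) mul1n muln_gcdl qE pE.
- have qR := congr1 (fun k : nat => k%:R : R) qE;
  have pR := congr1 (fun k : nat => k%:R : R) pE.
  rewrite /= !natrM in qR pR; apply: (le_lt_trans _ approx).
  rewrite -[in leRHS]qR -[in leRHS]pR mulrAC -mulrBl normrM.
  by rewrite ler_peMr// ger0_norm// ler1n.
Qed.

End DiophantineOrbits.

(** * Denjoy-Koksma estimates for badly approximable rotations *)

Section DampedSums.
Context {R : realType}.
Variable d : R.
Hypothesis d0 : 0 < d.

(** A bounded decreasing substitute for 1 / t, with primitive ln (t + d). *)
Definition damped (t : R) : R := (t + d)^-1.

Local Notation mass := (ln (1 + d) - ln d).

Lemma damped_gt0 t : 0 <= t -> 0 < damped t.
Proof. by move=> t0; rewrite invr_gt0 ltr_wpDl. Qed.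

Lemma damped0 : damped 0 = d^-1.
Proof. by rewrite /damped add0r. Qed.

Lemma le_damped s t : 0 <= s -> s <= t -> damped t <= damped s.
Proof.
move=> s0 st; rewrite lef_pV2 ?posrE ?lerD2r// ltr_wpDl//.
exact: le_trans st.
Qed.

Lemma damped_le t : 0 <= t -> damped t <= d^-1.
Proof. by move=> t0; rewrite -damped0 le_damped. Qed.

Lemma damped_step a h : 0 <= a -> 0 < h ->
  h * damped (a + h) <= ln (a + h + d) - ln (a + d) <= h * damped a.
Proof.
move=> a0 h0; have ad : 0 < a + d by rewrite ltr_wpDl.
have ahd : 0 < a + h + d by rewrite addrAC addr_gt0.
apply/andP; split.
  rewrite -lerN2 opprB -ln_div ?posrE// (le_trans (ln_le_subr1 _)) ?divr_gt0//.
  by rewrite /damped le_eqVlt; apply/orP; left; apply/eqP; field;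
    rewrite gt_eqF.
rewrite -ln_div ?posrE// (le_trans (ln_le_subr1 _)) ?divr_gt0//.
by rewrite /damped le_eqVlt; apply/orP; left; apply/eqP; field; rewrite gt_eqF.
Qed.

(** Comparison of a sum with the integral of a decreasing function. *)
Lemma damped_grid (q : nat) : (0 < q)%N ->
  q%:R * mass <= \sum_(i < q) damped (i%:R / q%:R) <= q%:R * mass + d^-1.
Proof.
move=> q0; have q0' : 0 < q%:R :> R by rewrite ltr0n.
pose G (i : nat) := ln (i%:R / q%:R + d).
have massE : mass = \sum_(i < q) (G i.+1 - G i).
  rewrite -(big_mkord xpredT (fun i => G i.+1 - G i)) telescope_sumr// /G.
  by rewrite divff ?gt_eqF// mul0r add0r.
have step (i : nat) : damped (i.+1%:R / q%:R) <= q%:R * (G i.+1 - G i) <=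
  damped (i%:R / q%:R).
  have iq : 0 <= i%:R / q%:R :> R by rewrite divr_ge0.
  have qV : 0 < q%:R^-1 :> R by rewrite invr_gt0.
  have := damped_step iq qV; rewrite /G -natr1 mulrDl mul1r => /andP[h1 h2].
  by rewrite -ler_pdivrMl// h1 -ler_pdivlMl.
rewrite massE mulr_sumr; apply/andP; split.
  by apply: ler_sum => i _; have /andP[] := step i.
apply: (@le_trans _ _ (\sum_(i < q.+1) damped (i%:R / q%:R))).
  by rewrite big_ord_recr/= lerDl ltW// damped_gt0// divr_ge0.
rewrite big_ord_recl/= mul0r damped0 addrC lerD2r.
by apply: ler_sum => i _; have /andP[] := step i.
Qed.

End DampedSums.

Section BlockSum.
Context {R : realType}.
Variables (d alpha : R) (q p : nat).
Hypothesis d0 : 0 < d.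
Hypothesis q0 : (0 < q)%N.
Hypothesis coprime_qp : coprime q p.
Hypothesis approx : `|q%:R * alpha - p%:R| <= q%:R^-1.

Local Notation mass := (ln (1 + d) - ln d).

Let q_gt0 : 0 < q%:R :> R. Proof. by rewrite ltr0n. Qed.

Let cellP (x : R) (n : nat) : ((Num.truncn (q%:R * x) + n * p) %% q < q)%N.
Proof. exact: ltn_pmod. Qed.

Let cell (x : R) (n : 'I_q) : 'I_q := Ordinal (cellP x n).

(** The points x + n p / q, for n < q, occupy each of the q cells exactly
    once, since p is invertible modulo q. *)
Let cell_inj x : injective (cell x).
Proof.
move=> m n /(congr1 val)/= /eqP; rewrite eqn_modDl => mn; apply: val_inj => /=.
wlog nm : m n mn / (n <= m)%N.
  by move=> wl; have [/wl|/ltnW nm] := leqP n m;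
    [apply|apply/esym/wl => //; rewrite eq_sym].
move: mn; rewrite eqn_mod_dvd ?leq_mul// -mulnBl Gauss_dvdl// => qmn.
apply/eqP; rewrite eqn_leq nm andbT -subn_eq0; apply: contraTT qmn => mn0.
rewrite gtnNdvd// ?lt0n//.
by rewrite (leq_ltn_trans (leq_subr _ _)).
Qed.

(** The error n (alpha - p / q) is smaller than 1 / q, so the n-th point lies
    at most one cell away from the cell of x + n p / q. *)
Let cell_pos x (n : 'I_q) : 0 <= x < 1 ->
  exists s : R, [/\ -1 < s, s < 2 & exists k : nat,
    x + n%:R * alpha = ((cell x n)%:R + s) / q%:R + k%:R].
Proof.
move=> /andP[x0 x1]; set u := Num.truncn (q%:R * x).
have /andP[u1 u2] : u%:R <= q%:R * x < u.+1%:R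
  by rewrite truncn_itv// mulr_ge0// ltW.
have n_le : `|n%:R * (q%:R * alpha - p%:R)| < 1.
  rewrite normrM normr_nat; apply: (@le_lt_trans _ _ (n%:R * q%:R^-1)).
    by rewrite ler_wpM2l.
  by rewrite ltr_pdivrMr// mul1r ltr_nat.
exists (q%:R * x - u%:R + n%:R * (q%:R * alpha - p%:R)).
move: n_le; rewrite ltr_norml => /andP[n1 n2]; rewrite -natr1 in u2.
split; [lra|lra|exists ((u + n * p) %/ q)%N].
have uE : u%:R + n%:R * p%:R = ((u + n * p) %/ q)%:R * q%:R + (cell x n)%:R :>
  R.
  by rewrite -!natrM -!natrD /= -divn_eq.
have -> : (cell x n)%:R = u%:R + n%:R * p%:R - ((u + n * p) %/ q)%:R *
  q%:R :> R.
  by rewrite uE addrAC subrr add0r.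
by field; rewrite gt_eqF.
Qed.

Let cell_bounds x (n : 'I_q) : 0 <= x < 1 ->
  let y := frac (x + n%:R * alpha) in
  (((cell x n).+1 < q)%N -> (cell x n).-1%:R / q%:R <= y) /\
  ((0 < cell x n)%N -> y <= (cell x n).+2%:R / q%:R).
Proof.
move=> x01 y; have [s [s1 s2 [k E]]] := cell_pos n x01.
have yE : 0 <= (cell x n)%:R + s < q%:R -> y = ((cell x n)%:R + s) / q%:R.
  move=> /andP[js0 jsq]; apply: (@frac_eq _ _ _ k%:Z); last by rewrite E.
  by rewrite divr_ge0// ltr_pdivrMr// mul1r.
have y0 : 0 <= y by exact: frac_ge0.
have y1 : y < 1 by exact: frac_lt1.
split=> [jq|j0].
  have jq' : (cell x n)%:R + 2 <= q%:R :> R by rewrite -natrD ler_nat addn2.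
  have [j0|j0] := posnP (cell x n); first by rewrite j0 mul0r.
  have jE : (cell x n).-1%:R + 1 = (cell x n)%:R :> R by rewrite natr1 prednK.
  have j1 : 1 <= (cell x n)%:R :> R by rewrite ler1n.
  rewrite yE ?ler_pM2r ?invr_gt0//; last by apply/andP; split; lra.
  lra.
have j1 : 1 <= (cell x n)%:R :> R by rewrite ler1n.
rewrite -addn2 natrD; have [jsq|jsq] := ltP ((cell x n)%:R + s) q%:R.
  rewrite yE ?ler_pM2r ?invr_gt0//; last by apply/andP; split; lra.
  lra.
rewrite (le_trans (ltW y1))// ler_pdivlMr// mul1r; lra.
Qed.

(** Each point is compared with the grid points on both sides of its cell; the
    two extreme cells, whose points may have crossed 0, cost d^-1 each. *)
Lemma block_sum x : 0 <= x < 1 ->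
  `|\sum_(n < q) damped d (frac (x + n%:R * alpha)) - q%:R * mass| <= 3 / d.
Proof.
move=> x01; have /andP[S1 S2] := damped_grid d0 q0.
set S := \sum_(i < q) damped d (i%:R / q%:R) in S1 S2.
pose y (n : nat) := frac (x + n%:R * alpha).
have y0 n : 0 <= y n by exact: frac_ge0.
have dV : 0 < d^-1 by rewrite invr_gt0.
have iq (i : nat) : 0 <= i%:R / q%:R :> R by rewrite divr_ge0.
have reidx (F : 'I_q -> R) : \sum_(n < q) F (cell x n) = \sum_(j < q) F j.
  by rewrite [RHS](reindex_inj (cell_inj (x := x))).
have one (j : 'I_q) : \sum_(i < q) (if i == j then d^-1 else 0) = d^-1.
  by rewrite -big_mkcond big_pred1_eq.
have grid0 : damped d (0%:R / q%:R) = d^-1 by rewrite mul0r damped0.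
have lastP : (q.-1 < q)%N by rewrite prednK.
have shift_le (f : nat -> R) k : (forall i, 0 <= f i) ->
    \sum_(j < k) f j.-1 <= \sum_(j < k) f j + f 0%N.
  move=> f0; case: k => [|k]; first by rewrite !big_ord0 add0r.
  by rewrite big_ord_recl [in leRHS]big_ord_recr/= [leLHS]addrC lerD2r lerDl.
pose last := Ordinal lastP; pose first := Ordinal q0.
have upper : \sum_(n < q) damped d (y n) <= S + 2 / d.
  apply: (@le_trans _ _ (\sum_(n < q) (damped d ((cell x n).-1%:R / q%:R) +
      (if cell x n == last then d^-1 else 0)))).
    apply: ler_sum => n _; have [b1 _] := cell_bounds n x01.
    have [jq|jq] := ltnP (cell x n).+1 q.
      apply: (@le_trans _ _ (damped d ((cell x n).-1%:R / q%:R))).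
        by rewrite le_damped// b1.
      by rewrite lerDl; case: ifP => // _; exact: ltW.
    have -> : cell x n == last.
      have jlt := ltn_ord (cell x n).
      by rewrite -val_eqE eqn_leq -ltnS prednK// jlt -ltnS prednK.
    by rewrite ler_wpDl ?damped_le// ltW// damped_gt0.
  rewrite (reidx (fun j : 'I_q => damped d (j.-1%:R / q%:R) +
    (if j == last then d^-1 else 0))).
  rewrite big_split/= one /S.
  suff : \sum_(j < q) damped d (j.-1%:R / q%:R) <= S + d^-1 by rewrite /S; lra.
  rewrite /S -grid0; apply: (@shift_le (fun i => damped d (i%:R / q%:R))) => i.
  by rewrite ltW// damped_gt0.
have lower : S - 3 / d <= \sum_(n < q) damped d (y n).
  apply: (@le_trans _ _ (\sum_(n < q) (damped d ((cell x n).+2%:R / q%:R) -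
      (if cell x n == first then d^-1 else 0)))); last first.
    apply: ler_sum => n _; have [_ b2] := cell_bounds n x01.
    have -> : (cell x n == first) = (nat_of_ord (cell x n) == 0%N) by [].
    have [j0|j0] := posnP (cell x n).
      apply: (@le_trans _ _ 0); first by rewrite subr_le0 damped_le.
      by rewrite ltW// damped_gt0.
    by rewrite subr0 le_damped// b2.
  rewrite (reidx (fun j : 'I_q => damped d (j.+2%:R / q%:R) -
    (if j == first then d^-1 else 0))).
  rewrite sumrB one.
  suff : S <= \sum_(j < q) damped d (j.+2%:R / q%:R) + 2 / d by lra.
  have damped_le' (i : nat) : damped d (i%:R / q%:R) <= d^-1
    by rewrite damped_le.
  have := damped_le' 1%N; have := damped_le' 0%N.
  have pos (i : nat) : 0 <= damped d (i%:R / q%:R) by rewrite ltW// damped_gt0.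
  have := pos q; have := pos q.+1.
  have : S + damped d (q%:R / q%:R) + damped d (q.+1%:R / q%:R) =
      damped d (0%:R / q%:R) + (damped d (1%:R / q%:R) +
        \sum_(j < q) damped d (j.+2%:R / q%:R)).
    pose f i := damped d (i%:R / q%:R).
    have : \sum_(i < q.+2) f i = \sum_(i < q.+2) f i by [].
    by rewrite {1}big_ord_recr/= big_ord_recr/= big_ord_recl/= big_ord_recl.
  lra.
rewrite ler_norml; apply/andP; split; lra.
Qed.

End BlockSum.

Section BadlyApproximableRotation.
Context {R : realType}.
Variables (alpha c : R).
Hypothesis alpha_gt0 : 0 < alpha.
Hypothesis c01 : 0 < c <= 1.
Hypothesis bad : forall (q : nat) (p : int), (0 < q)%N ->
  c / q%:R <= `|q%:R * alpha - p%:~R|.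

Let c0 : 0 < c. Proof. by case/andP: c01. Qed.

(** Peel off a block of q points, where q is the denominator given by
    Dirichlet's theorem at height N.  Bad approximability forces q >= c N, so
    ln N decreases by at least c for each block of cost 3 / d. *)
Lemma damped_orbit_sum (d : R) (N : nat) x : 0 < d -> (0 < N)%N -> 0 <= x < 1 ->
  `|\sum_(n < N) damped d (frac (x + n%:R * alpha)) - N%:R *
    (ln (1 + d) - ln d)|
    <= 3 / d * (1 + ln N%:R / c).
Proof.
move=> d0; have dV : 0 < 3 / d by rewrite divr_gt0.
move: x; have [n] := ubnP N; elim: n N => // n IHn N /ltnSE Nn x N0 x01.
have [q [p [/andP[q0 qN] qp approx]]] := dirichlet_coprime (ltW alpha_gt0) N0.
have N0' : 0 < N%:R :> R by rewrite ltr0n.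
have q0' : 0 < q%:R :> R by rewrite ltr0n.
have cq : c <= q%:R / N%:R.
  rewrite -ler_pdivrMl// mulrC; apply/ltW; apply: le_lt_trans approx.
  by have := bad p%:Z q0.
have approxq : `|q%:R * alpha - p%:R| <= q%:R^-1.
  by rewrite (le_trans (ltW approx))// lef_pV2 ?posrE// ler_nat.
have block := block_sum d0 q0 qp approxq x01.
have lnN0 : 0 <= ln N%:R :> R by rewrite ln_ge0// ler1n.
move: qN; rewrite leq_eqVlt => /predU1P[<-|qN].
  rewrite (le_trans block)// ler_peMr ?(ltW dV)// lerDl divr_ge0 ?(ltW c0)//.
  by rewrite ln_ge0// ler1n.
set x' := frac (x + q%:R * alpha).
have x'01 : 0 <= x' < 1 by rewrite frac_ge0 frac_lt1.
have Nq0 : (0 < N - q)%N by rewrite subn_gt0.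
have Nqn : (N - q < n)%N by rewrite (leq_trans _ Nn)// ltn_subrL q0.
have := IHn _ Nqn x' Nq0 x'01.
have splitE : \sum_(n0 < N) damped d (frac (x + n0%:R * alpha)) =
    \sum_(n0 < q) damped d (frac (x + n0%:R * alpha)) +
    \sum_(n0 < N - q) damped d (frac (x' + n0%:R * alpha)).
  rewrite -(big_mkord xpredT (fun i => damped d (frac (x + i%:R * alpha)))).
  rewrite (big_cat_nat (n := q))//= ?(ltnW qN)// big_mkord; congr (_ + _).
  rewrite -{1}(add0n q) big_addn big_mkord; apply: eq_bigr => i _.
  by rewrite fracD_frac natrD mulrDl -addrA [_ + q%:R * _]addrC.
rewrite splitE; set S1 := \sum_(_ < q) _ in block *;
  set S2 := \sum_(_ < N - q) _.
set mass := ln (1 + d) - ln d in block *.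
rewrite natrB ?(ltnW qN)//.
(* ln (1 - q / N) <= - q / N <= - c *)
have lnle : ln (N - q)%:R / c <= ln N%:R / c - 1.
  rewrite ler_pdivrMr// mulrBl mul1r divfK ?gt_eqF// lerBrDr -lerBrDl -lerN2
    opprB.
  rewrite -ln_div ?posrE ?ltr0n// (le_trans (ln_le_subr1 _)) ?divr_gt0 ?ltr0n//.
  rewrite natrB ?(ltnW qN)// mulrBl divff ?gt_eqF// addrAC subrr add0r lerN2.
  exact: cq.
rewrite natrB ?(ltnW qN)// in lnle.
move=> IH.
have -> : S1 + S2 - N%:R * mass =
  (S1 - q%:R * mass) + (S2 - (N%:R - q%:R) * mass) by ring.
rewrite (le_trans (ler_normD _ _))// (le_trans (lerD block IH))//.
have : 3 / d * (ln (N%:R - q%:R) / c) <= 3 / d * (ln N%:R / c - 1).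
  by rewrite ler_wpM2l// ltW.
lra.
Qed.

End BadlyApproximableRotation.

(** * Trimmed sums over separated points *)

Section SeparatedTrimmedSums.
Context {R : realType}.

Lemma sum_injective_le (N K : nat) (k : 'I_N -> nat) (h : nat -> R) :
  injective k -> (forall n, (k n < K)%N) -> (forall i, 0 <= h i) ->
  \sum_(n < N) h (k n) <= \sum_(i < K) h i.
Proof.
move=> kinj kK h0; pose k' n := Ordinal (kK n).
have k'inj : {in predT &, injective k'} by move=> m n _ _ /(congr1 val)/= /kinj.
rewrite -(big_imset (fun i : 'I_K => h i) k'inj)/=.
rewrite [leRHS](bigID [in k' @: predT])/= lerDl.
by apply: sumr_ge0.
Qed.

(** By separation each bin [i k, (i + 1) k[ contains at most one point, and
    bin 0 contains no nonzero point other than the removed one.  In bin i > 0,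
    1 / t exceeds its damped version by at most (A / k) (1/i - 1/(i+1)), which
    telescopes.  The removal itself and a possible point 0 cost one damped
    term each, hence 2 / d. *)
Lemma trimmed_separated (y : nat -> R) (N A : nat) (k : R) :
    0 < k -> (0 < N)%N -> (0 < A)%N -> (forall n, 0 <= y n) ->
    (forall m n, (m < N)%N -> (n < N)%N -> m != n -> k <= `|y m - y n|) ->
  `|trimmed (fun n => (y n)^-1) N - \sum_(n < N) damped (A%:R * k) (y n)| <=
  A%:R / k + 2 / (A%:R * k).
Proof.
move=> k0 N0 A0 y0 sep; set d := A%:R * k.
have A0' : 0 < A%:R :> R by rewrite ltr0n.
have d0 : 0 < d by rewrite mulr_gt0.
have dV : 0 < d^-1 by rewrite invr_gt0.
have [n0 n0_max ->] := trimmed_argmax (fun n => (y n)^-1) N0.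
pose bin (n : 'I_N) := Num.truncn (y n / k).
have Ak : 0 <= A%:R / k by rewrite divr_ge0// ltW.
have bin_le (n : 'I_N) : (bin n)%:R * k <= y n.
  by rewrite -ler_pdivlMr// truncn_le divr_ge0// ltW.
have bin_gt (n : 'I_N) : y n < (bin n)%:R * k + k.
  by rewrite -[X in _ + X]mul1r -mulrDl natr1 -ltr_pdivrMr// truncnS_gt.
have bin_inj : injective bin.
  move=> m n mn; apply/eqP/negPn/negP => mneqn.
  have := sep m n (ltn_ord m) (ltn_ord n) mneqn.
  rewrite leNgt => /negP; apply; rewrite ltr_norml.
  have := bin_le m; have := bin_gt m; have := bin_le n; have := bin_gt n.
  by rewrite mn => *; apply/andP; split; lra.
pose K := (\max_(n < N) bin n).+1.
have binK (n : 'I_N) : (bin n < K)%N by rewrite ltnS leq_bigmax.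
pose h (i : nat) : R := if i == 0%N then 0 else A%:R / k *
  (i%:R^-1 - i.+1%:R^-1).
have h0 i : 0 <= h i.
  rewrite /h; case: eqP => // /eqP; rewrite -lt0n => i0.
  rewrite mulr_ge0 ?divr_ge0 ?(ltW k0)// subr_ge0 lef_pV2 ?posrE ?ltr0n//
    ler_nat.
  exact: leqnSn.
have sum_h : \sum_(i < K) h i <= A%:R / k.
  rewrite /K big_ord_recl/= {1}/h/= add0r.
  suff : \sum_(i < \max_(n < N) bin n) h (bump 0 i) <=
    A%:R / k * (1 - (\max_(n < N) bin n).+1%:R^-1).
    by move=> /le_trans; apply; rewrite -[leRHS]mulr1 ler_wpM2l.
  elim: (\max_(n < N) bin n) => [|m IHm].
    by rewrite big_ord0 invr1 subrr mulr0.
  rewrite big_ord_recr/= (le_trans (lerD IHm (lexx _)))// /h /= -mulrDr.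
  by rewrite ler_wpM2l ?divr_ge0 ?(ltW k0)// addrA subrK.
have upper (n : 'I_N) : n != n0 -> (y n)^-1 <= damped d (y n) + h (bin n).
  move=> nn0; have [yn0|yn0] := eqVneq (y n) 0.
    by rewrite yn0 invr0 addr_ge0// ltW// damped_gt0.
  have yn : 0 < y n by rewrite lt0r yn0 y0.
  (* a nonzero point of bin 0 forces the smallest nonzero point, which is the
     removed one, into the same bin *)
  have b0 : (0 < bin n)%N.
    rewrite lt0n; apply: contra nn0 => /eqP bn0; apply/eqP/bin_inj.
    have yn0' : 0 < y n0.
      by rewrite -invr_gt0 (lt_le_trans _ (n0_max n))// invr_gt0.
    have yle : y n0 <= y n by have := n0_max n; rewrite lef_pV2.
    rewrite bn0; apply/eqP; rewrite eq_sym /bin truncn_eq ?divr_ge0 ?(ltW k0)//.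
    rewrite /= ltr_pdivrMr// mul1r (le_lt_trans yle)//.
    by have := bin_gt n; rewrite bn0 mul0r add0r.
  rewrite /h gtn_eqF// -lerBlDl /damped.
  set i := bin n in b0 *; have i0 : 0 < i%:R :> R by rewrite ltr0n.
  have iy : i%:R * k <= y n by exact: bin_le.
  have ik0 : 0 < i%:R * k by exact: mulr_gt0.
  have -> : (y n)^-1 - (y n + d)^-1 = d / (y n * (y n + d)).
    by field; rewrite !gt_eqF// addr_gt0.
  have -> : A%:R / k * (i%:R^-1 - i.+1%:R^-1) =
    d / ((i%:R * k) * ((i%:R + 1) * k)).
    by rewrite /d -natr1; field; rewrite !gt_eqF// addr_gt0.
  rewrite ler_wpM2l ?(ltW d0)// lef_pV2 ?posrE ?mulr_gt0 ?addr_gt0//.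
  apply: ler_pM => //; [exact: ltW|by rewrite mulr_ge0 ?addr_ge0 ?ltW|].
  rewrite mulrDl mul1r; apply: lerD => //.
  by rewrite /d ler_peMl ?(ltW k0)// ler1n.
(* equality at a point 0, which lies in bin 0 and has reciprocal 0 *)
have lower (n : 'I_N) : damped d (y n) - (if bin n == 0%N then d^-1 else 0) <=
  (y n)^-1.
  have [yn0|yn0] := eqVneq (y n) 0.
    by rewrite /bin yn0 mul0r truncn0 eqxx damped0 subrr invr0.
  have yn : 0 < y n by rewrite lt0r yn0 y0.
  apply: (@le_trans _ _ (damped d (y n))).
    by rewrite gerBl; case: ifP => // _; rewrite ltW.
  by rewrite /damped lef_pV2 ?posrE ?addr_gt0// lerDl ltW.
have sum_zero : \sum_(n < N) (if bin n == 0%N then d^-1 else 0) <= d^-1.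
  apply: (le_trans (@sum_injective_le _ K bin
    (fun i => if i == 0%N then d^-1 else 0) bin_inj binK _)).
    by move=> i; case: ifP => // _; exact: ltW.
  by rewrite /K big_ord_recl/= big1 ?addr0.
have damped_n0 : damped d (y n0) <= d^-1 by rewrite damped_le.
have damped_n0' : 0 <= damped d (y n0) by rewrite ltW// damped_gt0.
rewrite [\sum_(n < N) damped d (y n)](bigD1 n0)//=.
set F := \sum_(i < N | i != n0) damped d (y i).
have up : \sum_(n < N | n != n0) (y n)^-1 <= F + A%:R / k.
  apply: (@le_trans _ _ (\sum_(n < N | n != n0) (damped d (y n) + h (bin n)))).
    by apply: ler_sum => n /upper.
  rewrite big_split/= lerD2l (le_trans _ sum_h)//
    (le_trans _ (sum_injective_le bin_inj binK h0))//.
  by rewrite [leRHS](bigD1 n0)//= lerDr.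
have lo : F - d^-1 <= \sum_(n < N | n != n0) (y n)^-1.
  apply: (@le_trans _ _ (\sum_(n < N | n != n0)
    (damped d (y n) - (if bin n == 0%N then d^-1 else 0)))); last first.
    by apply: ler_sum => n _; exact: lower.
  rewrite sumrB lerD2l lerN2 (le_trans _ sum_zero)// [leRHS](bigD1 n0)//= lerDr.
  by case: ifP => // _; exact: ltW.
rewrite ler_norml; apply/andP; split; lra.
Qed.

End SeparatedTrimmedSums.

(** * The limit theorem *)

Section BoundedType.
Context {R : realType}.

Lemma uniform_cvg_normr (U : choiceType) (A : set U) (F : nat -> U -> R)
  (f : U -> R) :
  (forall e, 0 < e -> \forall N \near \oo, forall x, A x -> `|f x - F N x| < e)
    ->
  {uniform A, F @ \oo --> f}.
Proof.
move=> Fcvg Q /uniform_nbhs[E [/= + EQ]].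
rewrite -entourage_ballE => -[e /= e0 ballE].
apply: filterS (Fcvg e e0) => N FN; apply: EQ => x Ax.
by apply: ballE; exact: FN.
Qed.

Lemma badly_approximable_trimmed_sum (alpha c : R) :
    0 < alpha -> 0 < c <= 1 ->
    (forall (q : nat) (p : int), (0 < q)%N -> c / q%:R <=
      `|q%:R * alpha - p%:~R|) ->
  forall e, 0 < e -> \forall N \near \oo, forall x, 0 <= x < 1 ->
    `|1 - trimmed_sum alpha recip N x / (N%:R * ln N%:R)| < e.
Proof.
move=> alpha0 c01 bad e e0; have /andP[c0 c1] := c01.
(* makes the slope 3 / (A c^2) of the logarithmic error less than e / 2 *)
pose A := (Num.truncn (6 / (c ^+ 2 * e))).+1; pose D := A%:R * c.
have A0 : 0 < A%:R :> R by rewrite ltr0n.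
have D0 : 0 < D by exact: mulr_gt0.
have De : 3 / (D * c) < e / 2.
  have : 6 / (c ^+ 2 * e) < A%:R by exact: truncnS_gt.
  rewrite ltr_pdivrMr ?mulr_gt0 ?exprn_gt0// => H.
  by rewrite ltr_pdivrMr ?mulr_gt0// /D; lra.
pose C := A%:R / c + 5 / D + D + `|ln D|.
near=> N => x x01.
have N1 : (1 < N)%N by near: N; exists 2%N.
have N0 : 0 < N%:R :> R by rewrite ltr0n ltnW.
have N1' : 1 <= N%:R :> R by rewrite ler1n ltnW.
have lnN : 2 * C / e < ln N%:R.
  have : expR (2 * C / e) < N%:R by near: N; exact: nbhs_infty_gtr.
  move=> H; apply: (@le_lt_trans _ _ (ln (expR (2 * C / e))));
    first by rewrite expRK.
  by rewrite ltr_ln ?posrE ?expR_gt0.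
have ln0 : 0 < ln N%:R :> R by rewrite ln_gt0// ltr1n.
have NlN : 0 < N%:R * ln N%:R :> R by exact: mulr_gt0.
pose y n := frac (x + n%:R * alpha).
pose k := c / N%:R; have k0 : 0 < k by exact: divr_gt0.
have dE : A%:R * k = D / N%:R by rewrite mulrA.
have d0 : 0 < D / N%:R by exact: divr_gt0.
have := @trimmed_separated R y N A k k0 (ltnW N1) (ltn0Sn _)
  (fun n => frac_ge0 _)
  (fun m n => orbit_separated x c0 bad).
have := damped_orbit_sum alpha0 c01 bad d0 (ltnW N1) x01.
rewrite dE -trimmed_sumE// ln_div ?posrE//.
set T := trimmed_sum _ _ _ _; set S := \sum_(n < N) _.
have lnd1 : ln (1 + D / N%:R) <= D.
  by rewrite (le_trans (le_ln1Dx _))// ?ler_pdivrMr// ?ler_peMr ?(ltW D0)//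
    (lt_trans _ d0).
have lnd0 : 0 <= ln (1 + D / N%:R) by rewrite ln_ge0// lerDl ltW.
have -> : 3 / (D / N%:R) * (1 + ln N%:R / c) =
  N%:R * (3 / D + 3 / (D * c) * ln N%:R).
  by field; rewrite !gt_eqF.
have -> : A%:R / k + 2 / (D / N%:R) = N%:R * (A%:R / c + 2 / D).
  by rewrite /k; field; rewrite !gt_eqF.
have T_le : N%:R * (3 / D + 3 / (D * c) * ln N%:R) + N%:R * (A%:R / c + 2 / D) +
    N%:R * (D + `|ln D|) < e * (N%:R * ln N%:R).
  have -> : e * (N%:R * ln N%:R) = N%:R * (e * ln N%:R) by ring.
  rewrite -!mulrDr ltr_pM2l//.
  move: lnN; rewrite ltr_pdivrMr// /C => lnN.
  have : 3 / (D * c) * ln N%:R < e / 2 * ln N%:R by rewrite ltr_pM2r.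
  lra.
have mass_le : `|N%:R * (ln (1 + D / N%:R) - (ln D - ln N%:R)) - N%:R *
  ln N%:R| <=
    N%:R * (D + `|ln D|).
  have -> : N%:R * (ln (1 + D / N%:R) - (ln D - ln N%:R)) - N%:R * ln N%:R =
    N%:R * (ln (1 + D / N%:R) - ln D) by ring.
  rewrite normrM gtr0_norm// ler_wpM2l ?(ltW N0)//.
  by rewrite (le_trans (ler_normB _ _))// lerD2r ger0_norm.
move=> S_le TS_le.
have -> : 1 - T / (N%:R * ln N%:R) = (N%:R * ln N%:R - T) / (N%:R * ln N%:R).
  by field; rewrite !gt_eqF.
rewrite normf_div [`|N%:R * ln N%:R|]gtr0_norm// ltr_pdivrMr//.
apply: le_lt_trans T_le; rewrite -normrN opprB.
have -> : T - N%:R * ln N%:R =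
  (S - N%:R * (ln (1 + D / N%:R) - (ln D - ln N%:R))) +
  (T - S) + (N%:R * (ln (1 + D / N%:R) - (ln D - ln N%:R)) - N%:R * ln N%:R)
    by ring.
rewrite (le_trans (ler_normD _ _))// lerD// (le_trans (ler_normD _ _))// lerD//.
Unshelve. all: by end_near.
Qed.

End BoundedType.

Unset Implicit Arguments.

Theorem theorem8 (R : realType) :
  {ae (@lebesgue_measure R), forall alpha : R, 0 < alpha < 1 ->
    {ae (@lebesgue_measure R), forall x : R, 0 <= x < 1 ->
      (fun N : nat => trimmed_sum alpha recip N x / (N%:R * ln N%:R)) @ \oo
        --> (1 : R)}}
  /\
  (forall alpha : R, 0 < alpha < 1 -> irrational alpha ->
    bounded_type alpha ->
    {uniform [set x : R | 0 <= x < 1],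
      (fun (N : nat) (x : R) =>
         trimmed_sum alpha recip N x / (N%:R * ln N%:R)) @ \oo
        --> (fun=> 1 : R)}).
Proof.
split; first exact: ae_trimmed_sum_cvg1.
move=> alpha a01 irr bt; have /andP[a0 _] := a01.
have [c c01 bad] := bounded_type_badly_approximable a01 irr bt.
apply: uniform_cvg_normr => e e0.
exact: badly_approximable_trimmed_sum a0 c01 bad e e0.
Qed.
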